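(* Let $\alpha\in(\tfrac12,1)$ and let $s>\frac{1-\alpha}{4}$. Then there is a constant $C=C(\alpha,s)$ such that for all $f\in H^s(\mathbb{T})$, $$\|e^{it(-\Delta)^\alpha}f\|_{L^4_{t\in\mathbb{T}}L^4_{x\in\mathbb{T}}}\le C\,\|f\|_{H^s(\mathbb{T})}.$$
   Context: $\mathbb{T}=\mathbb{R}/2\pi\mathbb{Z}$; the norm on the left is the $L^4$ norm over $(t,x)\in[0,2\pi]\times[0,2\pi]$. $\widehat f(k)=\frac1{2\pi}\int_0^{2\pi}f(x)e^{-ikx}\,dx$; $\langle k\rangle=(1+k^2)^{1/2}$; $\|f\|_{H^s(\mathbb{T})}=\big(\sum_{k\in\mathbb{Z}}\langle k\rangle^{2s}|\widehat f(k)|^2\big)^{1/2}$. The propagator $e^{it(-\Delta)^\alpha}$ is the Fourier multiplier with symbol $e^{it|n|^{2\alpha}}$, $n\in\mathbb{Z}$. *)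

(* Defs.v *)
From HB Require Import structures.
From mathcomp Require Import all_boot all_order all_algebra.
From mathcomp Require Import complex.
From mathcomp Require Import all_classical all_reals all_analysis.

Set Implicit Arguments.
Unset Strict Implicit.
Unset Printing Implicit Defensive.

Import Order.TTheory GRing.Theory Num.Theory.
Import numFieldNormedType.Exports.

Local Open Scope classical_set_scope.
Local Open Scope ring_scope.
Local Open Scope complex_scope.

(* The torus is R / 2 pi Z: a function on it is a 2 pi-periodic function on R,
   and integrals over it are taken over [0, 2 pi]. [Normc.normc] is the
   R-valued modulus; the norm `|z| of R[i] is R[i]-valued. *)
Section Torus.
Context {R : realType}.
Implicit Types (f g : R -> R[i]) (k n : int).

Definition fund_dom : set R := `[0, 2 * pi]%classic.

Definition cis (t : R) : R[i] := cos t +i* sin t.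

Definition cintegrable (D : set R) f : Prop :=
  lebesgue_measure.-integrable D (fun x => (complex.Re (f x))%:E) /\
  lebesgue_measure.-integrable D (fun x => (complex.Im (f x))%:E).

Definition cintegral (D : set R) f : R[i] :=
  Rintegral lebesgue_measure D (fun x => complex.Re (f x)) +i*
  Rintegral lebesgue_measure D (fun x => complex.Im (f x)).

Definition L1_torus f : Prop :=
  (forall x, f (x + 2 * pi) = f x) /\ cintegrable fund_dom f.

Definition fourier_coef f k : R[i] :=
  ((2 * pi)^-1)%:C * cintegral fund_dom (fun x => f x * cis (- (k%:~R * x))).

Definition bracket k : R := Num.sqrt (1 + k%:~R ^+ 2).

Definition sobolev_norm (s : R) f : \bar R :=
  ((\esum_(k in [set: int])
      (bracket k `^ (2 * s) * Normc.normc (fourier_coef f k) ^+ 2)%:E) `^ 2^-1)%E.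

(* For s >= 0 every element of H^s is an L^2, hence L^1, function, so that
   for such s this is the whole of H^s. *)
Definition in_sobolev (s : R) f : Prop :=
  L1_torus f /\ (sobolev_norm s f < +oo)%E.

(* [g] represents the image of [f] under the multiplier with symbol [m];
   this determines [g] up to a null set. *)
Definition fourier_multiplier (m : int -> R[i]) f g : Prop :=
  L1_torus g /\ forall n, fourier_coef g n = m n * fourier_coef f n.

(* [g] represents e^{it(-Delta)^a} f. *)
Definition propagator (a t : R) f g : Prop :=
  fourier_multiplier (fun n => cis (t * `|n%:~R| `^ (2 * a))) f g.

Definition spacetime_measurable (u : R -> R -> R[i]) : Prop :=
  measurable_fun (fund_dom `*` fund_dom)
    (fun z : R * R => complex.Re (u z.1 z.2)) /\
  measurable_fun (fund_dom `*` fund_dom)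
    (fun z : R * R => complex.Im (u z.1 z.2)).

Definition L4_spacetime_norm (u : R -> R -> R[i]) : \bar R :=
  ('N[lebesgue_measure \x lebesgue_measure]_4%:E
    [(fun z : R * R => (Normc.normc (u z.1 z.2))%:E) \_ (fund_dom `*` fund_dom)])%E.

End Torus.

(* Main.v *)
Require Import Defs.
From mathcomp Require Import all_boot all_order all_algebra.
From mathcomp Require Import complex ring lra zify.
From mathcomp Require Import all_classical all_reals all_analysis.
From mathcomp Require Import measurable_realfun.

(* Write phi(n) = |n|^(2 alpha). For a finite sum u, |u|^4 = |u^2|^2 is a double
   sum over pairs (n1, n2); integrating in x keeps the pairs of pairs with equal
   n1 + n2, and integrating in t against the weight 1 + sin(t/2) >= 1_[0, 2 pi],
   which vanishes to second order at the ends of [-pi, 3 pi], gives a factor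
   decaying quadratically in the difference of the phases phi(n1) + phi(n2).
   Schur's test with the weights <n1>^(2s) <n2>^(2s) reduces the estimate to
     sum of <n1>^(-2s) <n2>^(-2s) over n1 + n2 = k, phi(n1) + phi(n2) in [m, m+1)
   being bounded uniformly in k and m. By convexity two points n < n + L of such
   a level set to the right of k/2 satisfy
     phi(z + L) + phi(z - L) - 2 phi(z) < 1 with z = k - n,
   and as phi''(x) is of size |x|^(2 alpha - 2), this gives L <= C <z>^(1 - alpha):
   the level set has O(<z>^(1 - alpha)) points for each of its z, and the summand
   is at most <z>^(-4s).

   For a general f, the Fejer means of u(t, .) are such finite sums with
   coefficients no larger than those of f, and they converge to u(t, .) in L^1;
   the convexity of the fourth power turns this into
   int |u(t, .)|^4 <= liminf of the fourth powers of the means, and Fatou's lemma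
   in t concludes. *)

Set Implicit Arguments.
Unset Strict Implicit.
Unset Printing Implicit Defensive.

Import Order.TTheory GRing.Theory Num.Theory.
Import numFieldNormedType.Exports.

Local Open Scope classical_set_scope.
Local Open Scope ring_scope.

(** * Quantitative convexity of powers *)

Section PowerConvexity.
Context {R : realType}.
Implicit Types (g h k x y z L : R).

(** Bernoulli's inequality for exponents in [(0, 1)]: Young's inequality for the product of
    [(1 + h) ^ k] and [1], with conjugate exponents [1 / k] and [1 / (1 - k)]. *)
Lemma powR_1D_le k h : 0 < k < 1 -> -1 <= h -> (1 + h) `^ k <= 1 + k * h.
Proof.
move=> /andP[k0 k1] h1.
have h0 : 0 <= 1 + h by lra.
have k0' : 0 < k^-1 by rewrite invr_gt0.
have k1' : 0 < (1 - k)^-1 by rewrite invr_gt0 subr_gt0.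
have := @conjugate_powR R ((1 + h) `^ k) 1 k^-1 (1 - k)^-1 (powR_ge0 _ _) ler01 k0' k1'.
rewrite !invrK -powRrM mulfV ?gt_eqF// powRr1// powR1 mulr1 mul1r.
move=> /(_ _)/le_trans; apply; first by rewrite subrKC.
by rewrite le_eqVlt; apply/orP; left; apply/eqP; ring.
Qed.

(* The left side is [(1 + h)^2 / (1 + (2 - g) h)]; apply Bernoulli's inequality
   with the exponent [2 - g < 1]. *)
Lemma powR_1D_ge_quadratic g h : 1 < g < 2 -> -1 <= h ->
  1 + g * h + (g - 1) ^+ 2 * h ^+ 2 / (1 + (2 - g) * h) <= (1 + h) `^ g.
Proof.
move=> /andP[g1 g2] h1.
have h0 : 0 <= 1 + h by lra.
have d0 : 0 < 1 + (2 - g) * h by nra.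
have -> : 1 + g * h + (g - 1) ^+ 2 * h ^+ 2 / (1 + (2 - g) * h)
   = (1 + h) ^+ 2 / (1 + (2 - g) * h).
  by field; rewrite gt_eqF.
have -> : (1 + h) ^+ 2 = (1 + h) `^ g * (1 + h) `^ (2 - g).
  by rewrite -powRD; [rewrite subrKC powR_mulrn|apply/implyP => /eqP; lra].
rewrite ler_pdivrMr//.
by apply: ler_wpM2l; [exact: powR_ge0|apply: powR_1D_le => //; lra].
Qed.

(** Evenness reduces to [z >= 0], and homogeneity allows scaling by the larger of [z] and [L], with
    ratio [h] in [[0, 1]]. Adding the quadratic Bernoulli bounds at [h] and [- h] cancels the linear
    terms and leaves the curvature. The factor [(|z| + L) ^ (2 - g)] reflects that the second
    derivative decays like [|x| ^ (g - 2)]. *)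
Lemma powR_second_difference g z L : 1 < g < 2 -> 0 <= L ->
  (g - 1) ^+ 2 * L ^+ 2 <=
  (`|z + L| `^ g + `|z - L| `^ g - 2 * `|z| `^ g) * (`|z| + L) `^ (2 - g).
Proof.
move=> g12 L0; have /andP[g1 g2] := g12.
wlog z0 : z / 0 <= z.
  move=> H; have [/H//|zN] := leP 0 z.
  have := H (- z); rewrite oppr_ge0 (ltW zN) => /(_ isT).
  rewrite -opprD normrN -[- z + L]opprK normrN opprD opprK normrN.
  by rewrite (addrC (`|z - L| `^ g)).
have c1 : 0 <= (g - 1) ^+ 2 <= 1 by nra.
have [Lz|zL] := leP L z.
  have [z00|zp] := eqVneq z 0.
    have -> : L = 0 by lra.
    by rewrite z00 !addr0 subr0 normr0 powR0 ?gt_eqF; lra.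
  have {zp}zp : 0 < z by rewrite lt_neqAle eq_sym zp.
  pose h := L / z.
  have Lh : L = z * h by rewrite /h mulrC divfK ?gt_eqF.
  have h0 : 0 <= h by rewrite divr_ge0.
  have h1 : h <= 1 by rewrite ler_pdivrMr// mul1r.
  have -> : z + L = z * (1 + h) by rewrite Lh; ring.
  have -> : z - L = z * (1 - h) by rewrite Lh; ring.
  rewrite !ger0_norm ?mulr_ge0//; [|lra|lra].
  rewrite !powRM//; [|lra|lra].
  have B1 := @powR_1D_ge_quadratic g h g12 ltac:(lra).
  have B2 := @powR_1D_ge_quadratic g (- h) g12 ltac:(lra).
  have w01 : 0 <= (2 - g) * h < 1 by nra.
  rewrite !mulrN in B2; set w : R := (2 - g) * h in w01 B1 B2.
  have E1 : 1 - w <= (1 + w)^-1.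
    by rewrite -[leRHS]mul1r ler_pdivlMr; nra.
  have E2 : 1 + w <= (1 - w)^-1.
    by rewrite -[leRHS]mul1r ler_pdivlMr; nra.
  set a := (1 + h) `^ g in B1 *; set b := (1 - h) `^ g in B2 *.
  have D : 2 * (g - 1) ^+ 2 * h ^+ 2 <= a + b - 2.
    have P0 : 0 <= (g - 1) ^+ 2 * h ^+ 2 by rewrite mulr_ge0 ?sqr_ge0.
    have := ler_wpM2l P0 E1; have := ler_wpM2l P0 E2.
    rewrite sqrrN in B2.
    rewrite -(mulrA 2); set P := _ * h ^+ 2 in P0 B1 B2 *; lra.
  have -> : z `^ g * a + z `^ g * b - 2 * z `^ g = z `^ g * (a + b - 2) by ring.
  have zz : z ^+ 2 = z `^ g * z `^ (2 - g).
    by rewrite -powRD; [rewrite subrKC powR_mulrn|apply/implyP => /eqP; lra].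
  have S : z `^ (2 - g) <= (z + L) `^ (2 - g).
    by apply: ge0_ler_powR; rewrite ?nnegrE; lra.
  apply: (@le_trans _ _ (z `^ g * (a + b - 2) * z `^ (2 - g))).
    rewrite [leRHS]mulrAC -zz Lh exprMn.
    have := ler_wpM2l (sqr_ge0 z) D.
    have : 0 <= (g - 1) ^+ 2 * (z ^+ 2 * h ^+ 2).
      by rewrite -exprMn mulr_ge0 ?sqr_ge0.
    lra.
  apply: ler_wpM2l => //; rewrite mulr_ge0 ?powR_ge0//.
  by apply: le_trans D; rewrite -mulrA -exprMn mulr_ge0 ?sqr_ge0.
have Lp : 0 < L by lra.
pose h := z / L.
have zh : z = L * h by rewrite /h mulrC divfK ?gt_eqF.
have h0 : 0 <= h by rewrite divr_ge0.
have h1 : h <= 1 by rewrite ler_pdivrMr// mul1r ltW.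
clearbody h.
have -> : z + L = L * (1 + h) by rewrite zh; ring.
have -> : `|z - L| = `|L * (1 - h)| by rewrite distrC zh; congr (`| _ |); ring.
have -> : `|z| + L = L * (1 + h) by rewrite ger0_norm// zh; ring.
rewrite {1}zh !ger0_norm ?mulr_ge0//; [|lra|lra].
rewrite (@powRM _ L (1 + h) g) ?(@powRM _ L (1 - h) g) ?(@powRM _ L h g)//; [|lra|lra].
have B1 := @powR_1D_ge_quadratic g h g12 ltac:(lra).
have B2 := @powR_1D_ge_quadratic g (- h) g12 ltac:(lra).
have w01 : 0 <= (2 - g) * h < 1 by nra.
rewrite !mulrN in B2; set w : R := (2 - g) * h in w01 B1 B2.
have E1 : 1 - w <= (1 + w)^-1.
  by rewrite -[leRHS]mul1r ler_pdivlMr; nra.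
have E2 : 1 + w <= (1 - w)^-1.
  by rewrite -[leRHS]mul1r ler_pdivlMr; nra.
have hg : h `^ g <= h.
  have [->|hn] := eqVneq h 0; first by rewrite powR0// gt_eqF//; lra.
  by apply: ge1r_powR; [rewrite h1 lt_neqAle eq_sym hn h0|exact: ltW].
set a := (1 + h) `^ g in B1 *; set b := (1 - h) `^ g in B2 *.
have D : 2 + 2 * (g - 1) ^+ 2 * h ^+ 2 <= a + b.
  have P0 : 0 <= (g - 1) ^+ 2 * h ^+ 2 by rewrite mulr_ge0 ?sqr_ge0.
  have := ler_wpM2l P0 E1; have := ler_wpM2l P0 E2.
  rewrite sqrrN in B2.
  rewrite -(mulrA 2); set P := _ * h ^+ 2 in P0 B1 B2 *; lra.
(* With [c <= 1] and [h ^ g <= h], the right side is at least [2 (1 - h) + 2 c h^2 >= 2 c (1 - h +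
   h^2) >= 3 c / 2]. *)
have D' : (g - 1) ^+ 2 <= a + b - 2 * h `^ g.
  have hh : 3 / 4 <= 1 - h + h ^+ 2 by have := sqr_ge0 (h - 2^-1); nra.
  move: c1 D; set c := (g - 1) ^+ 2 => /andP[cp cle] D.
  have H1 := ler_wpM2l cp hh.
  have H2 : c * (1 - h) <= 1 - h by rewrite ler_piMl//; lra.
  rewrite -mulrA in D; rewrite mulrDr in H1; lra.
have -> : L `^ g * a + L `^ g * b - 2 * (L `^ g * h `^ g)
   = L `^ g * (a + b - 2 * h `^ g) by ring.
have LL : L ^+ 2 = L `^ g * L `^ (2 - g).
  by rewrite -powRD; [rewrite subrKC powR_mulrn|apply/implyP => /eqP; lra].
have S : L `^ (2 - g) <= (L * (1 + h)) `^ (2 - g).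
  by apply: ge0_ler_powR; rewrite ?nnegrE; nra.
apply: (@le_trans _ _ (L `^ g * (a + b - 2 * h `^ g) * L `^ (2 - g))).
  by rewrite [leRHS]mulrAC -LL mulrC ler_wpM2l// sqr_ge0.
apply: ler_wpM2l => //; rewrite mulr_ge0 ?powR_ge0//.
by apply: le_trans D'; exact: sqr_ge0.
Qed.

Lemma powR_norm_convex g x y (t : R) : 1 <= g -> 0 <= t <= 1 ->
  `|t * x + (1 - t) * y| `^ g <= t * `|x| `^ g + (1 - t) * `|y| `^ g.
Proof.
move=> g1 /andP[t0 t1].
apply: (@le_trans _ _ ((t * `|x| + (1 - t) * `|y|) `^ g)).
  apply: ge0_ler_powR; rewrite ?nnegrE//; first lra.
    by rewrite addr_ge0 ?mulr_ge0//; lra.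
  apply: le_trans (ler_normD _ _) _; rewrite !normrM !(@ger0_norm _ t)//.
  by rewrite (@ger0_norm _ (1 - t)); lra.
by apply: (convex_powR g1 (Itv01 t0 t1));
  rewrite inE /= in_itv/= andbT.
Qed.

(** Increments of a convex function over a fixed length grow with the starting point. With [y = n]
    and [z = k - n] this replaces the increment at [n] by one at [k - n], completing a second
    difference there. *)
Lemma powR_norm_increment g z y L : 1 <= g -> z <= y -> 0 <= L ->
  `|y| `^ g + `|z + L| `^ g <= `|z| `^ g + `|y + L| `^ g.
Proof.
move=> g1 zy L0.
have [d0|dn] := eqVneq (y - z + L) 0.
  have -> : L = 0 by lra. have -> : z = y by lra.
  by rewrite addr0.
have dp : 0 < y - z + L by rewrite lt_neqAle eq_sym dn/=; lra.
pose t := L / (y - z + L).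
have t01 : 0 <= t <= 1.
  by rewrite divr_ge0 ?(ltW dp)//= ler_pdivrMr// mul1r; lra.
have tE : t * (y - z + L) = L by rewrite divfK.
(* [y] and [z + L] are convex combinations of [z] and [y + L] with swapped
   weights. *)
have E1 : y = t * z + (1 - t) * (y + L) by nra.
have E2 : z + L = t * (y + L) + (1 - t) * z by nra.
have H1 := powR_norm_convex z (y + L) g1 t01.
have H2 := powR_norm_convex (y + L) z g1 t01.
rewrite -E1 in H1; rewrite -E2 in H2; lra.
Qed.

End PowerConvexity.

(** * Level sets of the resonance function *)

Section Counting.
Context {R : realType}.

Lemma bracket_ge1 (k : int) : 1 <= bracket k :> R.
Proof. by rewrite /bracket -{1}(sqrtr1 R) ler_wsqrtr// lerDl sqr_ge0. Qed.

Lemma bracket_gt0 (k : int) : 0 < bracket k :> R.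
Proof. exact: lt_le_trans ltr01 (bracket_ge1 k). Qed.

Lemma le_bracket (k l : int) : `|k| <= `|l| -> bracket k <= bracket l :> R.
Proof.
move=> kl; rewrite /bracket ler_wsqrtr// lerD2l -[leLHS]real_normK ?num_real//.
rewrite -[leRHS]real_normK ?num_real// ler_sqr ?nnegrE// -!intr_norm.
by rewrite ler_int.
Qed.

Lemma bracketN (k : int) : bracket (- k) = bracket k :> R.
Proof. by rewrite /bracket mulrNz sqrrN. Qed.

Lemma card_int_ball_le (T : finType) (A : {pred T}) (nu : T -> int) (c : int) (r : R) :
  0 <= r -> {in A &, injective nu} ->
  (forall x, x \in A -> `|(nu x - c)%:~R| <= r) -> #|A|%:R <= 2 * r + 1.
Proof.
move=> r0 inj hA.
pose M := Num.truncn r.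
have hM x : x \in A -> (`|nu x - c| <= M)%N.
  by move=> /hA h; rewrite /M truncn_ge_nat// natr_absz intr_norm.
pose F x : 'I_(M.*2.+1) := inord `|nu x - c + M%:Z|.
have injF : {in A &, injective F}.
  move=> x y xA yA /(congr1 val); rewrite /F /= !inordK; last 2 first.
  - by have := hM _ yA; lia.
  - by have := hM _ xA; lia.
  by move=> E; apply: inj => //; have := hM _ xA; have := hM _ yA; lia.
have : (#|A| <= M.*2.+1)%N.
  by rewrite -(card_in_image injF) -[X in (_ <= X)%N]card_ord max_card.
rewrite -(ler_nat R) => /le_trans; apply.
rewrite -addn1 natrD lerD2r -mul2n natrM ler_wpM2l// /M.
by rewrite truncn_le.
Qed.


(* [w] stands for either end [z], [z - L] of the gap, hence [`|z| <= `|w| + L]. *)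
Lemma powR_level_gap g c (z w L : R) : 1 < g < 2 -> c = (g - 1) ^+ 2 ->
  0 <= L -> (L = 0 \/ 1 <= L) -> `|z| <= `|w| + L ->
  c * L ^+ 2 <= (`|z| + L) `^ (2 - g) ->
  L <= 4 / c * (Num.sqrt (1 + w ^+ 2)) `^ ((2 - g) / 2).
Proof.
move=> /andP[g1 g2] cE L0 L01 zw.
have c0 : 0 < c by rewrite cE exprn_gt0// subr_gt0.
have c1 : c <= 1 by rewrite cE; nra.
set B := Num.sqrt _; set b := (2 - g) / 2.
have B1 : 1 <= B by rewrite /B -{1}(sqrtr1 R) ler_wsqrtr// lerDl sqr_ge0.
have wB : `|w| <= B by rewrite /B -sqrtr_sqr ler_wsqrtr// lerDr.
have Bb1 : 1 <= B `^ b by rewrite -(powRr0 B); apply: ler_powR; rewrite // /b; lra.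
have ci : 1 <= c^-1 by rewrite -invr1 lef_pV2 ?posrE.
case: L01 => [->_|L1 H]; first by rewrite mulr_ge0 ?powR_ge0// divr_ge0// ltW.
have zB : 0 <= `|z| by [].
(* If [2 L <= |w|], then [|z| + L <= 2 |w|] and the right side is at most [2 B ^ (2 - g)]. Otherwise
   [|z| + L <= 4 L], and [L >= 1] gives [c L^2 <= (4 L) ^ (2 - g) <= 4 L], so [L <= 4 / c]. *)
have [Lw|wL] := leP (2 * L) `|w|.
  have : c * L ^+ 2 <= 2 * (B `^ b) ^+ 2.
    apply: le_trans H _.
    apply: (@le_trans _ _ ((2 * B) `^ (2 - g))).
      by apply: ge0_ler_powR; rewrite ?nnegrE; lra.
    rewrite powRM; [|lra|lra].
    rewrite -powR_mulrn ?powR_ge0// -powRrM (_ : b * 2 = 2 - g); last first.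
      by rewrite /b; field.
    by rewrite ler_wpM2r ?powR_ge0// ler1_powR; lra.
  set y := B `^ b in Bb1 *.
  rewrite mulrC -ler_pdivlMr// => {}H.
  have H2 : L ^+ 2 <= (4 * c^-1 * y) ^+ 2.
    apply: le_trans H _; rewrite mulrC; nra.
  by rewrite -ler_sqr ?nnegrE//; nra.
have : c * L ^+ 2 <= 4 * L.
  apply: le_trans H _.
  apply: (@le_trans _ _ ((4 * L) `^ (2 - g))).
    by apply: ge0_ler_powR; rewrite ?nnegrE; lra.
  by apply: ler1_powR; lra.
move=> {}H; have : L <= 4 / c by rewrite ler_pdivlMr//; nra.
by move=> /le_trans; apply; rewrite ler_peMr// divr_ge0// ltW.
Qed.

Variables (g s : R).
Hypotheses (hg : 1 < g < 2) (hs : (2 - g) / 2 <= 4 * s).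

Let phi (n : int) : R := `|n%:~R| `^ g.
Let wt (n : int) : R := bracket n `^ (- (2 * s)).
Let c := (g - 1) ^+ 2.

Let c_gt0 : 0 < c.
Proof. by rewrite /c exprn_gt0// subr_gt0; case/andP: hg. Qed.

(** Subtracting the two level conditions, the increment of [phi] at [n] plus its change from [k - n]
    to [k - n - L] is below 1. As [k - n <= n], the former dominates the increment at [k - n], so
    the second difference of [phi] at [k - n] is below 1. *)
Let level_gap (k n : int) (L : nat) (mu : R) :
  k <= 2 * n -> mu <= phi n + phi (k - n) < mu + 1 ->
  mu <= phi (n + L%:Z) + phi (k - (n + L%:Z)) < mu + 1 ->
  c * L%:R ^+ 2 <= (`|(k - n)%:~R| + L%:R) `^ (2 - g).
Proof.
move=> kn /andP[a1 a2] /andP[b1 b2].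
apply: le_trans (powR_second_difference _ hg _) _ => //.
apply: ler_piMl; first exact: powR_ge0.
have zy : (k - n)%:~R <= n%:~R :> R by rewrite ler_int; lia.
have /andP[g1 g2] := hg.
have := powR_norm_increment (ltW g1) zy (ler0n R L).
have e1 : (n + L%:Z)%:~R = n%:~R + L%:R :> R by rewrite intrD.
have e2 : (k - (n + L%:Z))%:~R = (k - n)%:~R - L%:R :> R.
  by rewrite opprD addrA [LHS]intrB.
move: b1 b2; rewrite /phi e1 e2; move: a1 a2; rewrite /phi.
set N := n%:~R; set Z := (k - n)%:~R => a1 a2 b1 b2; lra.
Qed.

(** With [B = <z> ^ ((2 - g) / 2)] for the smallest [z = k - n] in modulus, there are at most
    [8 B / c + 1] points, and each summand is at most [<z> ^ (- 4 s) <= B^-1]. Since [B >= 1], the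
    product is at most [8 / c + 1]. *)
Let counting_core (T : finType) (A : {pred T}) (nu : T -> int) (k : int) (mu : R) :
  {in A &, injective nu} -> 0 <= k ->
  (forall x, x \in A -> k <= 2 * nu x /\
     mu <= phi (nu x) + phi (k - nu x) < mu + 1) ->
  \sum_(x in A) wt (nu x) * wt (k - nu x) <= 8 / c + 1.
Proof.
move=> inj k0 hA.
have C0 : 0 <= 8 / c by rewrite divr_ge0// ltW.
have [A0|[x0 x0A]] : (A =i pred0) \/ exists x, x \in A.
  by case: (pickP (mem A)) => [x xA|A0]; [right; exists x|left].
  by rewrite big_pred0 ?addr_ge0.
(* All points lie within the gap bound of the one with the smallest [k - nu x],
   which also carries the largest summand. *)
case: (arg_minnP (fun x => `|k - nu x|%N) x0A) => x xA xmin.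
set zx := k - nu x in xmin *.
pose b : R := (2 - g) / 2.
pose B : R := bracket zx `^ b.
have B0 : 0 < B by rewrite powR_gt0// bracket_gt0.
have gap y : y \in A -> `|(nu y - nu x)%:~R| <= 4 / c * B.
  move=> yA.
  have [ky ly] := hA _ yA; have [kx lx] := hA _ xA.
  set L := `|nu y - nu x|%N.
  have -> : `|(nu y - nu x)%:~R| = L%:R :> R by rewrite natr_absz intr_norm.
  have L01 : L%:R = 0 :> R \/ 1 <= L%:R :> R.
    by case: L => [|n]; [left|right; rewrite ler1n].
  have [xy|yx] := leP (nu x) (nu y).
    have E : nu y = nu x + L%:Z.
      by rewrite /L gez0_abs ?subr_ge0// subrKC.
    apply: (@powR_level_gap g c zx%:~R zx%:~R) => //; first by rewrite lerDl.
    by apply: (level_gap kx lx); rewrite -E.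
  have E : nu x = nu y + L%:Z.
    by rewrite /L -abszN opprB gez0_abs ?subr_ge0 ?ltW// subrKC.
  apply: (@powR_level_gap g c (k - nu y)%:~R zx%:~R) => //.
    rewrite (_ : k - nu y = zx + L%:Z); last by rewrite /zx E; ring.
    by rewrite intrD (le_trans (ler_normD _ _))// lerD2l ger0_norm.
  by apply: (level_gap ky ly); rewrite -E.
have card : #|A|%:R <= 2 * (4 / c * B) + 1.
  by apply: card_int_ball_le inj gap; rewrite mulr_ge0 ?divr_ge0// ltW.
have term y : y \in A -> wt (nu y) * wt (k - nu y) <= B^-1.
  move=> yA; have [ky _] := hA _ yA.
  have h1 : bracket zx <= bracket (k - nu y) :> R.
    by apply: le_bracket; rewrite -!abszE lez_nat; exact: xmin yA.
  (* From [0 <= k <= 2 n] follows [|k - n| <= n], so the bracket of [k - n] is the smaller of the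
     two. *)
  have h2 : bracket zx <= bracket (nu y) :> R.
    apply: le_trans h1 _; apply: le_bracket.
    by move: (nu y) ky k0 {hA card gap xmin} => m; clear; lia.
  have s0 : 0 <= s by have /andP[g1 g2] := hg; move: hs; lra.
  have dec (u v : R) : 1 <= u -> u <= v -> v `^ (- (2 * s)) <= u `^ (- (2 * s)).
    move=> u1 uv; rewrite !powRN lef_pV2 ?posrE ?powR_gt0//; [|lra|lra].
    by apply: ge0_ler_powR; rewrite ?nnegrE; lra.
  apply: (@le_trans _ _ (bracket zx `^ (- (2 * s)) * bracket zx `^ (- (2 * s)))).
    by apply: ler_pM; rewrite ?powR_ge0 ?dec// bracket_ge1.
  rewrite -powRD; last by apply/implyP => _; rewrite gt_eqF// bracket_gt0.
  rewrite /B -powRN; apply: ler_powR; first exact: bracket_ge1.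
  by move: hs; rewrite /b -opprD lerN2 => /le_trans; apply; rewrite -mulrDl; lra.
apply: (@le_trans _ _ (\sum_(y in A) B^-1)); first exact: ler_sum.
rewrite sumr_const -[leLHS]mulr_natr.
have B1 : 1 <= B.
  rewrite /B -(powRr0 (bracket zx)); apply: ler_powR; first exact: bracket_ge1.
  by have /andP[g1 g2] := hg; rewrite /b; lra.
rewrite mulrC ler_pdivrMr//; apply: le_trans card _.
by rewrite [leRHS]mulrDl mul1r lerD// le_eqVlt (_ : 2 * _ = 8 / c * B) ?eqxx//; ring.
Qed.

Let phiN n : phi (- n) = phi n.
Proof. by rewrite /phi mulrNz normrN. Qed.

Let wtN n : wt (- n) = wt n.
Proof. by rewrite /wt bracketN. Qed.

(** The reflection [n -> k - n] preserves level and weight and exchanges the two sides of [k / 2];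
    hence the factor 2. *)
Let counting_nonneg (T : finType) (A : {pred T}) (nu : T -> int) (k : int) (mu : R) :
  {in A &, injective nu} -> 0 <= k ->
  (forall x, x \in A -> mu <= phi (nu x) + phi (k - nu x) < mu + 1) ->
  \sum_(x in A) wt (nu x) * wt (k - nu x) <= 2 * (8 / c + 1).
Proof.
move=> inj k0 hA.
rewrite (bigID (fun x => k <= 2 * nu x))/= mulr2n mulrDl mul1r; apply: lerD.
  apply: (@counting_core _ [pred x in A | k <= 2 * nu x] _ _ mu) => //.
    by move=> x y /andP[xA _] /andP[yA _]; exact: inj.
  by move=> x /andP[xA xk]; split=> //; exact: hA.
rewrite (eq_bigr (fun x => wt (k - nu x) * wt (k - (k - nu x)))); last first.
  by move=> x _; rewrite mulrC subKr.
apply: (@counting_core _ [pred x in A | ~~ (k <= 2 * nu x)]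
   (fun x => k - nu x) _ mu) => //.
  move=> x y /andP[xA _] /andP[yA _] /(congr1 (fun z => k - z)).
  by rewrite !subKr; exact: inj.
move=> x /andP[xA xk]; split; first by move: xk; lia.
by rewrite subKr addrC; exact: hA.
Qed.

Lemma level_set_weight_le (T : finType) (A : {pred T}) (nu : T -> int) (k : int) (mu : R) :
  {in A &, injective nu} ->
  (forall x, x \in A ->
    mu <= `|(nu x)%:~R| `^ g + `|(k - nu x)%:~R| `^ g < mu + 1) ->
  \sum_(x in A) bracket (nu x) `^ (- (2 * s)) * bracket (k - nu x) `^ (- (2 * s))
    <= 2 * (8 / (g - 1) ^+ 2 + 1).
Proof.
move=> inj hA; have [k0|k0] := leP 0 k; first exact: counting_nonneg hA.
(* Negating all frequencies changes neither the phases nor the weights, and makes [k] positive. *)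
rewrite (eq_bigr (fun x => wt (- nu x) * wt (- k - - nu x))); last first.
  by move=> x _; rewrite -opprD !wtN.
apply: (@counting_nonneg _ A (fun x => - nu x) (- k) mu) => //.
- by move=> x y xA yA /oppr_inj; exact: inj.
- by rewrite oppr_ge0 ltW.
by move=> x /hA; rewrite -opprD !phiN.
Qed.

End Counting.

(** * Integrals of trigonometric functions *)

Section HasIntegral.
Context {R : realType}.
Local Notation mu := (@lebesgue_measure R).
Implicit Types (D : set R) (f F : R -> R).

(** Carrying integrability along with the value lets finite trigonometric expansions be integrated
    term by term. *)
Definition has_integral D f (v : R) :=
  mu.-integrable D (EFin \o f) /\ (\int[mu]_(x in D) (f x)%:E = v%:E)%E.

Lemma has_integral_eq D f f' v : f =1 f' -> has_integral D f v -> has_integral D f' v.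
Proof. by move=> /funext ->. Qed.

Lemma has_integral_Rintegral D f v : has_integral D f v -> Rintegral mu D f = v.
Proof. by case=> _ H; rewrite /Rintegral H. Qed.

Lemma integrable_has_integral D f : @measurable _ (measurableTypeR R) D -> mu.-integrable D (EFin \o f) ->
  has_integral D f (Rintegral mu D f).
Proof.
by move=> mD fi; split => //; rewrite /Rintegral fineK//; exact: integrable_fin_num.
Qed.

Lemma has_integralD D f f' v v' : @measurable _ (measurableTypeR R) D ->
  has_integral D f v -> has_integral D f' v' ->
  has_integral D (fun x => f x + f' x) (v + v').
Proof.
move=> mD [fi fv] [f'i f'v]; split.
  by apply: (eq_integrable mD _ _ _ (integrableD mD fi f'i)).
by rewrite EFinD -fv -f'v -(integralD mD fi f'i).
Qed.

Lemma has_integralZ D f v k : @measurable _ (measurableTypeR R) D ->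
  has_integral D f v -> has_integral D (fun x => k * f x) (k * v).
Proof.
move=> mD [fi fv]; split.
  by apply: (eq_integrable mD _ _ _ (integrableZl mD k fi)).
by rewrite EFinM -fv -(integralZl mD fi).
Qed.

Lemma has_integral0 D : has_integral D (fun=> 0) 0.
Proof. by split; [exact: integrable0|exact: integral0]. Qed.

Lemma has_integral_sum D (I : Type) (r : seq I) (P : pred I) (f : I -> R -> R) v :
  @measurable _ (measurableTypeR R) D -> (forall i, P i -> has_integral D (f i) (v i)) ->
  has_integral D (fun x => \sum_(i <- r | P i) f i x) (\sum_(i <- r | P i) v i).
Proof.
move=> mD h; elim: r => [|i r IH].
  by rewrite big_nil; under eq_fun do rewrite big_nil; exact: has_integral0.
rewrite big_cons; under eq_fun do rewrite big_cons.
by case: ifPn => // Pi; apply: has_integralD => //; exact: h.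
Qed.

Lemma has_integral_norm_le D f v h w : @measurable _ (measurableTypeR R) D ->
  has_integral D f v -> has_integral D h w ->
  (forall x, D x -> `|f x| <= h x) -> `|v| <= w.
Proof.
move=> mD [fi fv] [hi hv] fh; rewrite -lee_fin -hv -abse_EFin -fv.
apply: le_trans (le_abse_integral _ mD _) _; first by case/integrableP: fi.
apply: ge0_le_integral => //.
- exact: (measurableT_comp (@abse_measurable R setT) (measurable_int mu fi)).
- exact: (measurable_int mu hi).
Qed.

Lemma has_integral_le D D' f v f' v' : @measurable _ (measurableTypeR R) D -> @measurable _ (measurableTypeR R) D' -> D `<=` D' ->
  has_integral D f v -> has_integral D' f' v' -> (forall x, D' x -> 0 <= f' x) ->
  (forall x, D x -> f x <= f' x) -> v <= v'.
Proof.
move=> mD mD' DD' [fi fv] [fi' fv'] f'0 ff'; rewrite -lee_fin -fv -fv'.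
apply: (@le_trans _ _ (\int[mu]_(x in D) (f' x)%:E)%E).
  apply: le_integral => //; first exact: (integrableS mD' mD DD' fi').
  by move=> x Dx; rewrite lee_fin ff'// -in_setE.
by apply: ge0_subset_integral => //; exact: (measurable_int mu fi').
Qed.

Lemma has_integral_derive (a b : R) f F : a < b ->
  (forall x : R, is_derive x 1 F (f x)) -> continuous f ->
  has_integral `[a, b] f (F b - F a).
Proof.
move=> ab dF cf; split.
  apply: continuous_compact_integrable; first exact: segment_compact.
  exact: continuous_subspaceT.
rewrite (@continuous_FTC2 _ f F)//.
- exact: continuous_subspaceT.
- have cF x : {for x, continuous F}.
    by apply: differentiable_continuous; apply/derivable1_diffP; exact: ex_derive.
  split=> //.
  + by apply: cvg_at_right_filter; exact: cF.
  + by apply: cvg_at_left_filter; exact: cF.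
- by move=> x _; rewrite derive1E; exact: derive_val.
Qed.

End HasIntegral.

Section TrigIntegrals.
Context {R : realType}.
Local Notation mu := (@lebesgue_measure R).

Lemma is_derive_sin_scale (l x : R) :
  is_derive x 1 (fun y => sin (l * y)) (l * cos (l * x)).
Proof.
have h : is_derive x 1 (fun y : R => l * y) l.
  by apply: is_derive_eq; rewrite /GRing.scale /= mulr1.
by rewrite mulrC; exact: (is_derive1_comp (is_derive_sin _) h).
Qed.

Lemma is_derive_cos_scale (l x : R) :
  is_derive x 1 (fun y => cos (l * y)) (- (l * sin (l * x))).
Proof.
have h : is_derive x 1 (fun y : R => l * y) l.
  by apply: is_derive_eq; rewrite /GRing.scale /= mulr1.
by rewrite mulrC -mulNr; exact: (is_derive1_comp (is_derive_cos _) h).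
Qed.

Lemma continuous_cos_scale (l : R) : continuous (fun y => cos (l * y)).
Proof.
move=> x; apply: (@continuous_comp _ _ _ (fun y => l * y) cos).
  exact: mulrl_continuous.
exact: continuous_cos.
Qed.

Lemma continuous_sin_scale (l : R) : continuous (fun y => sin (l * y)).
Proof.
move=> x; apply: (@continuous_comp _ _ _ (fun y => l * y) sin).
  exact: mulrl_continuous.
exact: continuous_sin.
Qed.

Lemma has_integral_cst (a b k : R) : a < b ->
  has_integral `[a, b] (fun=> k) (k * (b - a)).
Proof.
move=> ab; rewrite mulrBr; apply: (has_integral_derive (F := fun x => k * x)) => //.
- by move=> x; apply: is_derive_eq; rewrite /GRing.scale /= mulr1.
- by move=> x; exact: cvg_cst.
Qed.

Lemma has_integral_cos (a b l : R) : a < b -> l != 0 ->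
  has_integral `[a, b] (fun x => cos (l * x)) ((sin (l * b) - sin (l * a)) / l).
Proof.
move=> ab l0.
rewrite mulrBl ![_ / l]mulrC.
apply: (has_integral_derive (F := fun x => l^-1 * sin (l * x))) => //.
- move=> x; have := is_derive_sin_scale l x => h.
  by apply: is_derive_eq; rewrite /GRing.scale /= mulKf.
- exact: continuous_cos_scale.
Qed.

Lemma has_integral_sin (a b l : R) : a < b -> l != 0 ->
  has_integral `[a, b] (fun x => sin (l * x)) ((cos (l * a) - cos (l * b)) / l).
Proof.
move=> ab l0.
have -> : (cos (l * a) - cos (l * b)) / l
   = - l^-1 * cos (l * b) - (- l^-1 * cos (l * a)) by ring.
apply: (has_integral_derive (F := fun x => - l^-1 * cos (l * x))) => //.
- move=> x; have := is_derive_cos_scale l x => h.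
  by apply: is_derive_eq; rewrite /GRing.scale /= mulrNN mulKf.
- exact: continuous_sin_scale.
Qed.
End TrigIntegrals.

(** * Period integrals and the time weight *)

Section Weights.
Context {R : realType}.
Local Notation mu := (@lebesgue_measure R).

Lemma cos_int_period (k : int) : cos (k%:~R * (2 * pi)) = 1 :> R.
Proof.
wlog [n ->] : k / exists n : nat, k = n%:Z.
  move=> H; case: (intP k) => [|n|n]; first by apply: H; exists 0%N.
    by apply: H; exists n.+1.
  by rewrite mulrNz mulNr cosN; apply: H; exists n.+1.
have -> : n%:~R * (2 * pi) = 0 + (pi *+ 2) *+ n :> R.
  by rewrite add0r -(mulr_natl (pi *+ 2)) -(mulr_natl pi).
by rewrite (periodicn (@cosD2pi R)) cos0.
Qed.

Lemma sin_int_period (k : int) : sin (k%:~R * (2 * pi)) = 0 :> R.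
Proof. by apply: cos1sin0; rewrite cos_int_period normr1. Qed.

Lemma has_integral_cos_period (k : int) :
  has_integral fund_dom (fun x : R => cos (k%:~R * x)) (if k == 0 then 2 * pi else 0).
Proof.
have pi0 : 0 < 2 * pi :> R by rewrite mulr_gt0// pi_gt0.
case: eqVneq => [->|k0].
  have := has_integral_cst 1 pi0; rewrite subr0 mul1r.
  by apply: has_integral_eq => x; rewrite mul0r cos0.
have := @has_integral_cos R 0 (2 * pi) k%:~R pi0.
by rewrite intr_eq0 => /(_ k0); rewrite mulr0 sin0 sin_int_period subr0 mul0r.
Qed.

Lemma has_integral_sin_period (k : int) :
  has_integral fund_dom (fun x : R => sin (k%:~R * x)) 0.
Proof.
have pi0 : 0 < 2 * pi :> R by rewrite mulr_gt0// pi_gt0.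
have [->|k0] := eqVneq k 0.
  have := has_integral_cst 0 pi0; rewrite mul0r.
  by apply: has_integral_eq => x; rewrite mul0r sin0.
have := @has_integral_sin R 0 (2 * pi) k%:~R pi0.
by rewrite intr_eq0 => /(_ k0); rewrite mulr0 cos0 cos_int_period subrr mul0r.
Qed.

(* The weight vanishes to second order at both ends of [time_dom], which makes its
   Fourier transform decay fast enough to be summable. *)
Definition time_weight (t : R) : R := 1 + sin (2^-1 * t).
Definition time_dom : set R := `[- pi, 3 * pi]%classic.
(* [288 = 9 * 32]: for [`|l| < 2] the integral is at most [8 pi < 32], and the
   denominator of [weight_decay l] at most [9]. *)
Definition decay_const : R := 288.
Definition weight_decay (l : R) : R := decay_const / (`|Num.floor l|.+1)%:R ^+ 2.

Lemma decay_const_ge0 : 0 <= decay_const.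
Proof. exact: ler0n. Qed.

Lemma measurable_fund_dom : @measurable _ (measurableTypeR R) fund_dom.
Proof. exact: measurable_itv. Qed.

Lemma measurable_time_dom : @measurable _ (measurableTypeR R) time_dom.
Proof. exact: measurable_itv. Qed.

Lemma time_weight_ge0 t : 0 <= time_weight t.
Proof. by rewrite /time_weight -lerBlDl sub0r sin_geN1. Qed.

Lemma time_weight_ge1 t : fund_dom t -> 1 <= time_weight t.
Proof.
rewrite /fund_dom /= in_itv /= => /andP[t0 t1].
by rewrite /time_weight lerDl sin_ge0_pi//; lra.
Qed.

Lemma time_weight_le2 t : time_weight t <= 2.
Proof. by have := sin_le1 (2^-1 * t); rewrite /time_weight; lra. Qed.

Lemma continuous_time_weight : continuous time_weight.
Proof.
by move=> t; apply: continuousD; [exact: cvg_cst|exact: continuous_sin_scale].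
Qed.

Let sin_3pihalf (x : R) : (sin (x + 3 * pi / 2) = - cos x) * (cos (x + 3 * pi / 2) = sin x).
Proof.
have -> : x + 3 * pi / 2 = x + pi / 2 + pi by field.
by rewrite sinDpi cosDpi sinDpihalf cosDpihalf opprK.
Qed.

Let sin_N3pihalf (x : R) : (sin (x - 3 * pi / 2) = cos x) * (cos (x - 3 * pi / 2) = - sin x).
Proof.
split; have -> : x - 3 * pi / 2 = - (- x + 3 * pi / 2) by ring.
  by rewrite sinN sin_3pihalf opprK cosN.
by rewrite cosN sin_3pihalf sinN.
Qed.

Let pi_bounds : 0 < pi :> R /\ pi < 4 :> R.
Proof. by split; [exact: pi_gt0|have := @pihalf_lt2 R; lra]. Qed.

Let time_dom_lt : - pi < 3 * pi :> R.
Proof. by have [] := pi_bounds; lra. Qed.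

Let bounded_case (l : R) (f : R -> R) : `|l| < 2 -> continuous f ->
  (forall x, `|f x| <= 1) ->
  exists2 v, has_integral time_dom (fun t => time_weight t * f t) v &
    `|v| <= weight_decay l.
Proof.
move=> l2 cf f1.
exists (Rintegral mu time_dom (fun t => time_weight t * f t)).
  apply: (integrable_has_integral measurable_time_dom).
  apply: continuous_compact_integrable; first exact: segment_compact.
  apply: continuous_subspaceT => x.
  by apply: continuousM; [exact: continuous_time_weight|exact: cf].
have [p0 p4] := pi_bounds.
have fl : (`|Num.floor l|.+1%:R <= 3 :> R).
  have /andP[a1 a2] : - 2 < l < 2 by rewrite -ltr_norml.
  rewrite ler_nat ltnS; have : Num.floor l < 2 by rewrite floor_lt_int.
  have : - 2 <= Num.floor l by rewrite floor_ge_int ltW.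
  by clear; lia.
apply: (@le_trans _ _ (2 * (3 * pi - - pi))).
  apply: (has_integral_norm_le measurable_time_dom _ (has_integral_cst 2 time_dom_lt)).
    apply: (integrable_has_integral measurable_time_dom).
    apply: continuous_compact_integrable; first exact: segment_compact.
    apply: continuous_subspaceT => x.
    by apply: continuousM; [exact: continuous_time_weight|exact: cf].
  move=> x _; rewrite normrM -[2]mulr1 ler_pM//.
  by rewrite ger0_norm ?time_weight_ge0// time_weight_le2.
rewrite /weight_decay ler_pdivlMr ?exprn_gt0//.
set m := _%:R in fl *; have m0 : 0 <= m by rewrite ler0n.
have : m ^+ 2 <= 9 by nra.
by rewrite /decay_const; nra.
Qed.

(** The three reciprocals cancel to [- 1 / (4 l (l^2 - 1/4))], which decays cubically and is
    therefore at most [1 / l^2] after multiplication by [S]. *)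
Let large_case (l S : R) : 2 <= `|l| -> `|S| <= 2 ->
  `|S * (l^-1 - 2^-1 / (l + 2^-1) - 2^-1 / (l - 2^-1))| <= weight_decay l.
Proof.
move=> l2 S2.
have ll : 4 <= l ^+ 2 by rewrite -[l ^+ 2]ger0_norm ?sqr_ge0// normrX; nra.
have l0 : l != 0 by apply/eqP => l0; move: ll; rewrite l0; nra.
have l1 : l + 2^-1 != 0 by apply/eqP => l1; nra.
have l1' : l - 2^-1 != 0 by apply/eqP => l1'; nra.
have l3 : l ^+ 2 - 4^-1 != 0 by apply/eqP; nra.
have -> : l^-1 - 2^-1 / (l + 2^-1) - 2^-1 / (l - 2^-1) =
    - (4^-1 / (l * (l ^+ 2 - 4^-1))).
  have -> : l ^+ 2 - 4^-1 = (l + 2^-1) * (l - 2^-1) by field.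
  field; rewrite l0 /=; apply/andP; split.
    by apply/eqP => E; case/eqP: l1'; lra.
  by rewrite andbT; apply/eqP => E; case/eqP: l1; lra.
have q0 : 0 < l ^+ 2 - 4^-1 by lra.
rewrite normrM normrN (normrM 4^-1) (normfV (l * _)) (normrM l).
rewrite (ger0_norm (ltW q0)) (@ger0_norm _ 4^-1)//.
apply: (@le_trans _ _ (l ^+ 2)^-1).
  rewrite mulrA ler_pdivrMr; last by rewrite mulr_gt0 ?normr_gt0//; lra.
  rewrite [leRHS]mulrC ler_pdivlMr; last by lra.
  have : 2 * (l ^+ 2 - 4^-1) <= `|l| * (l ^+ 2 - 4^-1) by rewrite ler_wpM2r//; lra.
  have : `|S| * l ^+ 2 <= 2 * l ^+ 2 by rewrite ler_wpM2r//; lra.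
  by lra.
rewrite /weight_decay ler_pdivlMr ?exprn_gt0//.
rewrite mulrC ler_pdivrMr; last by lra.
(* As [|l| >= 2], one has [|floor l| + 1 <= |l| + 2 <= 2 |l|]. *)
have fl : (`|Num.floor l|.+1%:R <= 2 * `|l| :> R).
  rewrite -natr1 natr_absz intr_norm.
  have /andP[] := floor_itv l.
  rewrite intrD => f1 f2.
  have : `|(Num.floor l)%:~R| <= `|l| + 1 :> R.
    rewrite ler_norml; apply/andP; split.
      by have := ler_norm (- l); rewrite normrN; lra.
    by have := ler_norm l; lra.
  by lra.
apply: (@le_trans _ _ ((2 * `|l|) ^+ 2)).
  by rewrite ler_sqr ?nnegrE// mulr_ge0.
by rewrite exprMn -normrX ger0_norm ?sqr_ge0// /decay_const; lra.
Qed.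

Let norm_add2 (x y : R) : `|x| <= 1 -> `|y| <= 1 -> `|x + y| <= 2.
Proof. by move=> x1 y1; apply: le_trans (ler_normD _ _) _; lra. Qed.

(** The product formula turns the integrand into oscillations of frequencies [l], [l + 1/2] and
    [l - 1/2]. At the ends of [time_dom] the half frequencies shift the argument by quarter periods,
    so all boundary terms share the factor [sin (3 l pi) + sin (l pi)], and the remaining
    combination of reciprocals is the one in [large_case]. *)
Lemma has_integral_weight_cos (l : R) :
  exists2 v, has_integral time_dom (fun t => time_weight t * cos (l * t)) v &
    `|v| <= weight_decay l.
Proof.
have [l2|l2] := ltP `|l| 2.
  apply: bounded_case => //; first exact: continuous_cos_scale.
  by move=> x; exact: cos_max.
have l0 : l != 0 by apply/eqP => l0; move: l2; rewrite l0 normr0; lra.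
have l1 : l + 2^-1 != 0.
  by apply/eqP => l1; have E : l = - 2^-1; [lra|move: l2; rewrite E normrN ger0_norm; lra].
have l1' : l - 2^-1 != 0.
  by apply/eqP => l1'; have E : l = 2^-1; [lra|move: l2; rewrite E ger0_norm; lra].
have H1 := has_integral_cos time_dom_lt l0.
have H2 := has_integralZ 2^-1 measurable_time_dom (has_integral_sin time_dom_lt l1).
have H3 := has_integralZ (- 2^-1) measurable_time_dom (has_integral_sin time_dom_lt l1').
have H := has_integralD measurable_time_dom (has_integralD measurable_time_dom H1 H2) H3.
eexists; first apply: has_integral_eq H => t.
  by rewrite mulrDl mulrBl sinD sinB /time_weight; field.
have -> : (l + 2^-1) * (- pi) = - (l * pi + pi / 2) by field.
have -> : (l + 2^-1) * (3 * pi) = l * (3 * pi) + 3 * pi / 2 by field.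
have -> : (l - 2^-1) * (- pi) = - (l * pi - pi / 2) by field.
have -> : (l - 2^-1) * (3 * pi) = l * (3 * pi) - 3 * pi / 2 by field.
rewrite mulrN sinN !cosN cosDpihalf cosBpihalf sin_3pihalf sin_N3pihalf.
set s1 := sin (l * pi); set s3 := sin (l * (3 * pi)).
rewrite [X in `|X|](_ : _ = (s3 + s1) * (l^-1 - 2^-1 / (l + 2^-1) - 2^-1 / (l - 2^-1))).
  by apply: large_case => //; apply: norm_add2; exact: sin_max.
by ring.
Qed.

(** As for the cosine, with the common boundary factor [cos (l pi) - cos (3 l pi)]. *)
Lemma has_integral_weight_sin (l : R) :
  exists2 v, has_integral time_dom (fun t => time_weight t * sin (l * t)) v &
    `|v| <= weight_decay l.
Proof.
have [l2|l2] := ltP `|l| 2.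
  apply: bounded_case => //; first exact: continuous_sin_scale.
  by move=> x; exact: sin_max.
have l0 : l != 0 by apply/eqP => l0; move: l2; rewrite l0 normr0; lra.
have l1 : l + 2^-1 != 0.
  by apply/eqP => l1; have E : l = - 2^-1; [lra|move: l2; rewrite E normrN ger0_norm; lra].
have l1' : l - 2^-1 != 0.
  by apply/eqP => l1'; have E : l = 2^-1; [lra|move: l2; rewrite E ger0_norm; lra].
have H1 := has_integral_sin time_dom_lt l0.
have H2 := has_integralZ (- 2^-1) measurable_time_dom (has_integral_cos time_dom_lt l1).
have H3 := has_integralZ 2^-1 measurable_time_dom (has_integral_cos time_dom_lt l1').
have H := has_integralD measurable_time_dom (has_integralD measurable_time_dom H1 H2) H3.
eexists; first apply: has_integral_eq H => t.
  by rewrite mulrDl mulrBl cosD cosB /time_weight; field.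
have -> : (l + 2^-1) * (- pi) = - (l * pi + pi / 2) by field.
have -> : (l + 2^-1) * (3 * pi) = l * (3 * pi) + 3 * pi / 2 by field.
have -> : (l - 2^-1) * (- pi) = - (l * pi - pi / 2) by field.
have -> : (l - 2^-1) * (3 * pi) = l * (3 * pi) - 3 * pi / 2 by field.
rewrite mulrN !sinN cosN sinDpihalf sinBpihalf sin_3pihalf sin_N3pihalf.
set s1 := cos (l * pi); set s3 := cos (l * (3 * pi)).
rewrite [X in `|X|](_ : _ = (s1 + - s3) * (l^-1 - 2^-1 / (l + 2^-1) - 2^-1 / (l - 2^-1))).
  by apply: large_case => //; apply: norm_add2; rewrite ?normrN; exact: cos_max.
by ring.
Qed.

End Weights.

(** * Schur's test *)

Section SchurBound.
Context {R : realType}.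

(** Telescoping: [1 / (x + 1)^2 <= 1 / x - 1 / (x + 1)], so induction works for the stronger bound
    [2 - 1 / B]. *)
Lemma sum_inv_sqr_le (B : nat) : \sum_(m < B) ((m.+1)%:R ^+ 2)^-1 <= 2 :> R.
Proof.
case: B => [|B]; first by rewrite big_ord0.
suff : \sum_(m < B.+1) ((m.+1)%:R ^+ 2)^-1 <= 2 - (B.+1%:R)^-1 :> R.
  by move=> /le_trans; apply; rewrite gerBl.
elim: B => [|B IH]; first by rewrite big_ord1 expr1n invr1; lra.
rewrite big_ord_recr/=; apply: (le_trans (lerD IH (lexx _))).
have -> : B.+2%:R = B.+1%:R + 1 :> R by rewrite natr1.
have : 1 <= B.+1%:R :> R by rewrite ler1n.
move: (B.+1%:R) => x x1.
have x0 : 0 < x by lra.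
have : x^-1 - (x + 1)^-1 = (x * (x + 1))^-1.
  by field; rewrite !gt_eqF//; lra.
have : ((x + 1) ^+ 2)^-1 <= (x * (x + 1))^-1.
  by rewrite lef_pV2 ?posrE ?exprn_gt0 ?mulr_gt0//; nra.
by lra.
Qed.

Lemma weight_decay_ge0 (l : R) : 0 <= weight_decay l.
Proof. by rewrite divr_ge0 ?decay_const_ge0// exprn_ge0. Qed.

(* [weight_decay] is not even because of the floor. *)
Lemma weight_decayN (l : R) : weight_decay (- l) <= 4 * weight_decay l.
Proof.
have /andP[a1 a2] := floor_itv l; have /andP[b1 b2] := floor_itv (- l).
(* The two floors add up to 0 or -1, so [|floor| + 1] changes at most by a factor 2 under
   negation. *)
have c1 : Num.floor l + Num.floor (- l) <= 0.
  by rewrite -(ler_int R) intrD; lra.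
have c2 : - 2 < Num.floor l + Num.floor (- l).
  by rewrite -(ltr_int R) intrD mulrNz; move: a2 b2; rewrite !intrD; lra.
rewrite /weight_decay mulrCA ler_wpM2l ?decay_const_ge0//.
set u := (`|Num.floor (- l)|.+1)%:R : R; set v := (`|Num.floor l|.+1)%:R : R.
have u0 : 0 < u by rewrite ltr0n.
have v0 : 0 < v by rewrite ltr0n.
have vu : v <= 2 * u.
  by rewrite /v /u -natrM ler_nat; move: c1 c2; clear; lia.
rewrite ler_pdivlMr ?exprn_gt0// mulrC ler_pdivrMr ?exprn_gt0//.
by rewrite (_ : 4 * u ^+ 2 = (2 * u) ^+ 2); [rewrite ler_sqr ?nnegrE; lra|ring].
Qed.

(** The weighted arithmetic-geometric mean inequality splits [a j * a k] into two squares; the row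
    bound handles the sum of the first, the column bound that of the second. *)
Lemma schur_bound (J : finType) (a om : J -> R) (M : J -> J -> R) (S : R) :
  (forall j, 0 < om j) -> (forall j k, 0 <= M j k) ->
  (forall j, \sum_k (om k)^-1 * M j k <= S) ->
  (forall k, \sum_j (om j)^-1 * M j k <= S) ->
  \sum_j \sum_k a j * a k * M j k <= S * \sum_j om j * a j ^+ 2.
Proof.
move=> om0 M0 row col.
have am (j k : J) : a j * a k * M j k <=
    2^-1 * (om j * a j ^+ 2 * ((om k)^-1 * M j k)) +
    2^-1 * (om k * a k ^+ 2 * ((om j)^-1 * M j k)).
  rewrite -subr_ge0.
  rewrite (_ : _ - _ = 2^-1 * M j k * (om j * om k)^-1 * (om j * a j - om k * a k) ^+ 2).
    apply: mulr_ge0 (sqr_ge0 _); apply: mulr_ge0; first exact: mulr_ge0.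
    by rewrite invr_ge0 mulr_ge0// ltW.
  by field; rewrite !gt_eqF.
apply: (@le_trans _ _ (\sum_j \sum_k
    (2^-1 * (om j * a j ^+ 2 * ((om k)^-1 * M j k)) +
     2^-1 * (om k * a k ^+ 2 * ((om j)^-1 * M j k))))).
  by apply: ler_sum => j _; apply: ler_sum => k _; exact: am.
under eq_bigr do rewrite big_split/=.
rewrite big_split/= [X in _ + X <= _]exchange_big /=.
have -> : S * \sum_j om j * a j ^+ 2 =
   \sum_j 2^-1 * (om j * a j ^+ 2 * S) + \sum_j 2^-1 * (om j * a j ^+ 2 * S).
  by rewrite -big_split mulr_sumr; apply: eq_bigr => j _ /=; field.
apply: lerD; apply: ler_sum => j _; rewrite -!mulr_sumr ler_wpM2l//.
  by rewrite ler_wpM2l ?row// mulr_ge0 ?sqr_ge0// ltW.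
by rewrite ler_wpM2l ?col// mulr_ge0 ?sqr_ge0// ltW.
Qed.

Variables (g s : R).
Hypotheses (hg : 1 < g < 2) (hs : (2 - g) / 2 <= 4 * s).
Let C1 : R := 2 * (8 / (g - 1) ^+ 2 + 1).

(** [C1] bounds one unit level set, the inner 2 accounts for the two signs of the floor, and the
    last 2 bounds the sum of inverse squares. *)
Definition resonance_const : R := decay_const * (2 * C1) * 2.

Let C1_ge0 : 0 <= C1.
Proof. by rewrite mulr_ge0// addr_ge0// divr_ge0// sqr_ge0. Qed.

Lemma resonance_const_ge0 : 0 <= resonance_const.
Proof.
apply: mulr_ge0 => //; apply: (mulr_ge0 decay_const_ge0).
by rewrite mulr_ge0// C1_ge0.
Qed.

Variables (I : finType) (n : I -> int).
Hypothesis n_inj : injective n.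

Let J := (I * I)%type.
Let freq (j : J) : int := n j.1 + n j.2.
Let phase (j : J) : R := `|(n j.1)%:~R| `^ g + `|(n j.2)%:~R| `^ g.
Let wt (j : J) : R := bracket (n j.1) `^ (- (2 * s)) * bracket (n j.2) `^ (- (2 * s)).

Let wt_ge0 j : 0 <= wt j.
Proof. by rewrite mulr_ge0 ?powR_ge0. Qed.

Let level_sum (k : int) (l : R) (m : int) :
  \sum_(j | (freq j == k) && (Num.floor (phase j - l) == m)) wt j <= C1.
Proof.
pose A := [pred j : J | (freq j == k) && (Num.floor (phase j - l) == m)].
have E j : j \in A -> n j.2 = k - n j.1.
  by move=> /andP[/eqP <- _]; rewrite /freq addrC addKr.
rewrite (eq_bigr (fun j => bracket (n j.1) `^ (- (2 * s))
    * bracket (k - n j.1) `^ (- (2 * s)))); last by move=> j Aj; rewrite -E.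
apply: (@level_set_weight_le R g s hg hs J A (fun j => n j.1) k (l + m%:~R)).
  move=> x y xA yA /= e; have e1 := n_inj e.
  have e2 : x.2 = y.2 by apply: n_inj; rewrite !E// e.
  by move: e1 e2; clear; case: x; case: y => /= ? ? ? ? -> ->.
move=> x xA; rewrite -E//; case/andP: xA => _ /eqP <-.
have /andP[a1] := floor_itv (phase x - l).
by move: a1; rewrite intrD /phase => a1 a2; apply/andP; split; lra.
Qed.

Lemma resonance_sum_le (k : int) (l : R) :
  \sum_(j | freq j == k) wt j * weight_decay (phase j - l) <= resonance_const.
Proof.
pose m (j : J) := `|Num.floor (phase j - l)|%N.
pose B := (\max_j m j).+1.
have mB j : (m j < B)%N by rewrite ltnS; exact: leq_bigmax.
rewrite (partition_big (fun j => Ordinal (mB j)) predT)//=.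
apply: (@le_trans _ _ (\sum_(i < B) decay_const * (2 * C1) * ((i.+1)%:R ^+ 2)^-1)).
  apply: ler_sum => i _.
  rewrite (eq_bigr (fun j => decay_const / (i.+1)%:R ^+ 2 * wt j)); last first.
    by move=> j /andP[_ /eqP <-]; rewrite mulrC.
  rewrite -mulr_sumr [leRHS]mulrAC ler_wpM2l ?divr_ge0 ?decay_const_ge0 ?exprn_ge0//.
  (* The pairs whose floor has modulus [i] lie in the level sets of the floors [i] and [- i]. *)
  rewrite (bigID (fun j => 0 <= Num.floor (phase j - l)))/= mulr2n mulrDl mul1r.
  apply: lerD.
    apply: le_trans (level_sum k l i).
    rewrite [leRHS](bigID (fun j => (freq j == k) && (Ordinal (mB j) == i) &&
      (0 <= Num.floor (phase j - l))))/= -[leLHS]addr0; apply: lerD; last first.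
      by apply: sumr_ge0.
    rewrite le_eqVlt; apply/orP; left; apply/eqP; apply: eq_bigl => j.
    case: (freq j == k) => //=; rewrite -val_eqE /= /m.
    by apply/idP/idP; lia.
  apply: le_trans (level_sum k l (- i%:Z)).
  rewrite [leRHS](bigID (fun j => (freq j == k) && (Ordinal (mB j) == i) &&
    ~~ (0 <= Num.floor (phase j - l))))/= -[leLHS]addr0; apply: lerD; last first.
    by apply: sumr_ge0.
  rewrite le_eqVlt; apply/orP; left; apply/eqP; apply: eq_bigl => j.
  case: (freq j == k) => //=; rewrite -val_eqE /= /m.
  by apply/idP/idP; lia.
by rewrite -mulr_sumr ler_wpM2l ?sum_inv_sqr_le// (mulr_ge0 decay_const_ge0)// mulr_ge0// C1_ge0.
Qed.

(** Schur's test with the inverse weights. The columns are [resonance_sum_le] itself; the rows have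
    the phase difference reversed, which costs the factor 4 of [weight_decayN]. *)
Lemma quadrilinear_le (a : J -> R) :
  \sum_j \sum_k a j * a k *
    (if freq j == freq k then weight_decay (phase j - phase k) else 0)
  <= 4 * resonance_const * \sum_j (wt j)^-1 * a j ^+ 2.
Proof.
have C0 := resonance_const_ge0.
apply: schur_bound.
- by move=> j; rewrite invr_gt0 mulr_gt0// powR_gt0// bracket_gt0.
- by move=> j k; case: ifP => // _; exact: weight_decay_ge0.
- move=> j; under eq_bigr do rewrite invrK.
  apply: (@le_trans _ _ (\sum_(k | freq k == freq j) 4 * (wt k * weight_decay (phase k - phase j)))).
    rewrite [leRHS]big_mkcond/=; apply: ler_sum => k _.
    rewrite eq_sym; case: ifP => _; last by rewrite mulr0.
    by rewrite [leRHS]mulrCA ler_wpM2l// -[phase j - _]opprB weight_decayN.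
  by rewrite -mulr_sumr ler_wpM2l// resonance_sum_le.
- move=> k; under eq_bigr do rewrite invrK.
  apply: (@le_trans _ _ (\sum_(j | freq j == freq k) wt j * weight_decay (phase j - phase k))).
    rewrite [leRHS]big_mkcond/=; apply: ler_sum => j _.
    by case: ifP => _; last by rewrite mulr0.
  by apply: le_trans (resonance_sum_le _ _) _; lra.
Qed.

End SchurBound.

(** * The estimate for finite sums *)

Section FiniteStrichartz.
Context {R : realType}.
Local Notation mu := (@lebesgue_measure R).
Local Notation Re := (@complex.Re R).
Local Notation Im := (@complex.Im R).

Lemma normc_ge0 (z : R[i]) : 0 <= Normc.normc z.
Proof. by case: z => a b; exact: sqrtr_ge0. Qed.

Lemma normc_sqrE (z : R[i]) : Normc.normc z ^+ 2 = Re z ^+ 2 + Im z ^+ 2.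
Proof. by case: z => a b /=; rewrite sqr_sqrtr// addr_ge0 ?sqr_ge0. Qed.

Lemma Re_addc (z w : R[i]) : Re (z + w) = Re z + Re w.
Proof. by case: z; case: w. Qed.

Lemma Im_addc (z w : R[i]) : Im (z + w) = Im z + Im w.
Proof. by case: z; case: w. Qed.

Lemma Re_sum (J : Type) (r : seq J) (P : pred J) (F : J -> R[i]) :
  Re (\sum_(j <- r | P j) F j) = \sum_(j <- r | P j) Re (F j).
Proof. exact: (big_morph Re Re_addc). Qed.

Lemma Im_sum (J : Type) (r : seq J) (P : pred J) (F : J -> R[i]) :
  Im (\sum_(j <- r | P j) F j) = \sum_(j <- r | P j) Im (F j).
Proof. exact: (big_morph Im Im_addc). Qed.

Lemma Re_mulc (z w : R[i]) : Re (z * w) = Re z * Re w - Im z * Im w.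
Proof. by case: z; case: w. Qed.

Lemma Im_mulc (z w : R[i]) : Im (z * w) = Re z * Im w + Im z * Re w.
Proof. by case: z; case: w. Qed.

Lemma cisD (x y : R) : cis (x + y) = cis x * cis y.
Proof.
by apply/eqP; rewrite eq_complex Re_mulc Im_mulc /= cosD sinD !eqxx/= addrC eqxx.
Qed.

(* Real and imaginary part of [c * d^*]. *)
Definition cross_re (c d : R[i]) : R := Re c * Re d + Im c * Im d.
Definition cross_im (c d : R[i]) : R := Im c * Re d - Re c * Im d.

Lemma sqr_normc_sum_cis (J : finType) (c : J -> R[i]) (th : J -> R) :
  Normc.normc (\sum_j c j * cis (th j)) ^+ 2 =
  \sum_j \sum_k (cross_re (c j) (c k) * cos (th j - th k) -
                 cross_im (c j) (c k) * sin (th j - th k)).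
Proof.
rewrite normc_sqrE Re_sum Im_sum !expr2 !big_distrlr/= -big_split/=.
apply: eq_bigr => j _; rewrite -big_split/=; apply: eq_bigr => k _.
by rewrite !Re_mulc !Im_mulc /cross_re /cross_im /cis /= cosB sinB; ring.
Qed.

Lemma cross_le (c d : R[i]) :
  `|cross_re c d| <= Normc.normc c * Normc.normc d /\
  `|cross_im c d| <= Normc.normc c * Normc.normc d.
Proof.
have E : cross_re c d ^+ 2 + cross_im c d ^+ 2 =
    (Normc.normc c * Normc.normc d) ^+ 2.
  by rewrite exprMn !normc_sqrE /cross_re /cross_im; ring.
have n0 : 0 <= Normc.normc c * Normc.normc d by rewrite mulr_ge0 ?normc_ge0.
by split; rewrite -ler_sqr ?nnegrE// real_normK ?num_real// -E ?lerDl ?lerDr sqr_ge0.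
Qed.

Variables (g s : R).
Hypotheses (hg : 1 < g < 2) (hs : (2 - g) / 2 <= 4 * s).
Variables (I : finType) (n : I -> int) (b : I -> R[i]).
Hypothesis n_inj : injective n.

Definition disp_sum (t x : R) : R[i] :=
  \sum_i b i * cis (t * `|(n i)%:~R| `^ g) * cis ((n i)%:~R * x).

Let J := (I * I)%type.
Let c (j : J) : R[i] := b j.1 * b j.2.
Let freq (j : J) : int := n j.1 + n j.2.
Let phase (j : J) : R := `|(n j.1)%:~R| `^ g + `|(n j.2)%:~R| `^ g.
Let A (j k : J) := cross_re (c j) (c k).
Let B (j k : J) := cross_im (c j) (c k).

Let pow4E (t x : R) : Normc.normc (disp_sum t x) ^+ 4 =
  \sum_j \sum_k
   ((A j k * cos ((phase j - phase k) * t) - B j k * sin ((phase j - phase k) * t)) *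
       cos ((freq j - freq k)%:~R * x) +
    (- A j k * sin ((phase j - phase k) * t) - B j k * cos ((phase j - phase k) * t)) *
       sin ((freq j - freq k)%:~R * x)).
Proof.
have -> : Normc.normc (disp_sum t x) ^+ 4 = Normc.normc (disp_sum t x * disp_sum t x) ^+ 2.
  by rewrite Normc.normcM -expr2 -exprM.
have -> : disp_sum t x * disp_sum t x =
    \sum_j c j * cis (phase j * t + (freq j)%:~R * x).
  rewrite /disp_sum big_distrlr pair_big/=; apply: eq_bigr => -[i k] _ /=.
  by rewrite /c /phase /freq /= intrD !mulrDl !cisD !(mulrC t); ring.
rewrite sqr_normc_sum_cis; apply: eq_bigr => j _; apply: eq_bigr => k _.
rewrite (_ : _ + _ - (_ + _) = (phase j - phase k) * t + (freq j - freq k)%:~R * x); last first.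
  by rewrite intrB; ring.
by rewrite cosD sinD /A /B; ring.
Qed.

(** This is the integral over [x] of the fourth power of the modulus: orthogonality keeps only the
    terms with equal frequency sums. *)
Definition disp_sum_energy (t : R) : R :=
  \sum_(j : J) \sum_(k : J)
   (A j k * cos ((phase j - phase k) * t) - B j k * sin ((phase j - phase k) * t)) *
      (if freq j - freq k == 0 then 2 * pi else 0).

Lemma has_integral_disp_sum (t : R) :
  has_integral fund_dom (fun x => Normc.normc (disp_sum t x) ^+ 4) (disp_sum_energy t).
Proof.
rewrite /disp_sum_energy.
apply: has_integral_eq; first by move=> x; exact/esym/pow4E.
apply: has_integral_sum => [|j _]; first exact: measurable_fund_dom.
apply: has_integral_sum => [|k _]; first exact: measurable_fund_dom.
set p := A j k * _ - _; set q := - A j k * _ - _.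
have H1 := has_integralZ p measurable_fund_dom (has_integral_cos_period (freq j - freq k)).
have H2 := has_integralZ q measurable_fund_dom (has_integral_sin_period (freq j - freq k)).
by have := has_integralD measurable_fund_dom H1 H2; rewrite mulr0 addr0.
Qed.

Lemma disp_sum_energy_ge0 t : 0 <= disp_sum_energy t.
Proof.
rewrite -(has_integral_Rintegral (has_integral_disp_sum t)).
by apply: Rintegral_ge0 => x _; rewrite exprn_ge0// normc_ge0.
Qed.

(** Stated for any weight and domain because it serves twice: with [time_weight] on [time_dom] for
    the bound, and with weight 1 on [fund_dom] for the integral to be bounded. *)
Let energy_exists (f : R -> R) (D : set R) (V : R -> R) (W : R -> R) :
  @measurable _ (measurableTypeR R) D ->
  (forall l, has_integral D (fun t => f t * cos (l * t)) (V l)) ->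
  (forall l, has_integral D (fun t => f t * sin (l * t)) (W l)) ->
  has_integral D (fun t => f t * disp_sum_energy t)
    (\sum_j \sum_k (A j k * V (phase j - phase k) - B j k * W (phase j - phase k)) *
       (if freq j - freq k == 0 then 2 * pi else 0)).
Proof.
move=> mD hV hW.
apply: (@has_integral_eq _ _ (fun t => \sum_j \sum_k
   (if freq j - freq k == 0 then 2 * pi else 0) *
   (A j k * (f t * cos ((phase j - phase k) * t)) +
    - B j k * (f t * sin ((phase j - phase k) * t))))).
  move=> t; rewrite /disp_sum_energy mulr_sumr; apply: eq_bigr => j _.
  by rewrite mulr_sumr; apply: eq_bigr => k _; ring.
apply: has_integral_sum => // j _; apply: has_integral_sum => // k _.
rewrite [X in has_integral _ _ X]mulrC; apply: has_integralZ => //.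
by rewrite -mulNr; apply: has_integralD => //; exact: has_integralZ.
Qed.

(** [4 pi] is [2 pi] from the integral in [x], doubled for the cosine and sine terms; the other
    factor comes from [quadrilinear_le]. *)
Definition strichartz_const : R := 4 * pi * (4 * resonance_const g).

Lemma strichartz_const_ge0 : 0 <= strichartz_const.
Proof.
apply: mulr_ge0; apply: mulr_ge0 => //; first exact: pi_ge0.
exact: resonance_const_ge0.
Qed.

Lemma finite_strichartz : exists2 v, has_integral fund_dom disp_sum_energy v &
  v <= strichartz_const *
    (\sum_i bracket (n i) `^ (2 * s) * Normc.normc (b i) ^+ 2) ^+ 2.
Proof.
have exV (l : R) : exists v : R,
    has_integral time_dom (fun t => time_weight t * cos (l * t)) v /\
    `|v| <= weight_decay l.
  by have [v ? ?] := @has_integral_weight_cos R l; exists v.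
have exW (l : R) : exists v : R,
    has_integral time_dom (fun t => time_weight t * sin (l * t)) v /\
    `|v| <= weight_decay l.
  by have [v ? ?] := @has_integral_weight_sin R l; exists v.
have [V hV] := choice exV; have [W hW] := choice exW.
have H1 := energy_exists measurable_time_dom (fun l => (hV l).1) (fun l => (hW l).1).
have int_cts (f : R -> R) : continuous f ->
    has_integral fund_dom f (Rintegral mu fund_dom f).
  move=> cf; apply: (integrable_has_integral measurable_fund_dom).
  apply: continuous_compact_integrable; first exact: segment_compact.
  exact: continuous_subspaceT.
have cosI (l : R) : has_integral fund_dom (fun t => 1 * cos (l * t))
    (Rintegral mu fund_dom (fun t => 1 * cos (l * t))).
  apply: int_cts; rewrite (_ : (fun t => _) = (fun t => cos (l * t))).
    exact: continuous_cos_scale.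
  by apply/funext => t; rewrite mul1r.
have sinI (l : R) : has_integral fund_dom (fun t => 1 * sin (l * t))
    (Rintegral mu fund_dom (fun t => 1 * sin (l * t))).
  apply: int_cts; rewrite (_ : (fun t => _) = (fun t => sin (l * t))).
    exact: continuous_sin_scale.
  by apply/funext => t; rewrite mul1r.
have H2 := has_integral_eq (fun t => mul1r _) (energy_exists measurable_fund_dom cosI sinI).
eexists; first exact: H2.
(* The energy is nonnegative and the weight is at least 1 on [fund_dom], so the weighted integral
   over [time_dom] dominates. *)
apply: le_trans (has_integral_le measurable_fund_dom measurable_time_dom _ H2 H1 _ _) _.
- move=> t; rewrite /fund_dom /time_dom /= !in_itv/= => /andP[t0 t1].
  by have := @pi_ge0 R; move=> ?; apply/andP; split; lra.
- by move=> t _; rewrite mulr_ge0 ?time_weight_ge0// disp_sum_energy_ge0.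
- move=> t Dt; rewrite ler_peMl ?disp_sum_energy_ge0//; exact: time_weight_ge1.
pose a (j : J) := Normc.normc (c j).
apply: (@le_trans _ _ (4 * pi * \sum_j \sum_k a j * a k *
    (if freq j == freq k then weight_decay (phase j - phase k) else 0))).
  rewrite mulr_sumr; apply: ler_sum => j _; rewrite mulr_sumr; apply: ler_sum => k _.
  rewrite subr_eq0; case: ifP => _; last by rewrite !mulr0.
  have [a1 b1] := cross_le (c j) (c k).
  have [_ v1] := hV (phase j - phase k); have [_ w1] := hW (phase j - phase k).
  have e1 : `|A j k * V (phase j - phase k)| <= a j * a k * weight_decay (phase j - phase k).
    by rewrite normrM ler_pM.
  have e2 : `|B j k * W (phase j - phase k)| <= a j * a k * weight_decay (phase j - phase k).
    by rewrite normrM ler_pM.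
  have p0 := @pi_ge0 R.
  rewrite (_ : 4 * pi * _ = (2 * (a j * a k * weight_decay (phase j - phase k))) * (2 * pi)); last by ring.
  rewrite ler_wpM2r ?mulr_ge0//.
  have := ler_norm (A j k * V (phase j - phase k)).
  have := ler_norm (- (B j k * W (phase j - phase k))); rewrite normrN.
  by lra.
rewrite /strichartz_const -[leRHS]mulrA ler_wpM2l ?mulr_ge0 ?pi_ge0//.
apply: le_trans (quadrilinear_le hg hs n_inj a) _.
rewrite le_eqVlt; apply/orP; left; apply/eqP; congr (_ * _).
(* Coefficients and weights of pairs are products, so the sum over pairs is the square of a sum over
   single frequencies. *)
rewrite expr2 big_distrlr pair_big/=; apply: eq_bigr => -[i k] _ /=.
rewrite /a /c /= Normc.normcM exprMn invfM -!powRN !opprK; ring.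
Qed.

End FiniteStrichartz.

(** * Fejer means *)

Section Fejer.
Context {R : realType}.
Local Notation mu := (@lebesgue_measure R).
Local Notation D := (@fund_dom R).
Local Notation mD := (@measurable_fund_dom R).
Local Notation integrable_on h := (mu.-integrable D (EFin \o h)).
Implicit Types (h : R -> R) (x y : R) (N : nat).

(** The usual kernel with coefficients [1 - |m| / (N + 1)], indexed by pairs with [m = j - k], which
    displays it as the squared modulus of a geometric sum. *)
Definition fejer_kernel N y : R :=
  N.+1%:R^-1 * \sum_(j < N.+1) \sum_(k < N.+1) cos ((j%:Z - k%:Z)%:~R * y).

Lemma fejer_kernelE N y :
  fejer_kernel N y = N.+1%:R^-1 * Normc.normc (\sum_(j < N.+1) cis y ^+ j) ^+ 2.
Proof.
have cisX j : cis y ^+ j = 1 * cis (j%:R * y) :> R[i].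
  elim: j => [|j IH]; first by rewrite expr0 mul0r /cis cos0 sin0 mul1r.
  by rewrite exprS IH -natr1 mulrDl mul1r cisD !mul1r mulrC.
under [in RHS]eq_bigr do rewrite cisX.
rewrite sqr_normc_sum_cis; congr (_ * _); apply: eq_bigr => j _; apply: eq_bigr => k _.
have -> : (j%:Z - k%:Z)%:~R * y = j%:R * y - k%:R * y by rewrite intrB mulrBl.
by rewrite /cross_re /cross_im /=; ring.
Qed.

Lemma fejer_kernel_ge0 N y : 0 <= fejer_kernel N y.
Proof. by rewrite fejer_kernelE mulr_ge0 ?invr_ge0// exprn_ge0// normc_ge0. Qed.

(** Since [2 (1 - cos y)] is the squared modulus of [cis y - 1], multiplying by it collapses the
    geometric sum to [cis y ^ (N + 1) - 1], of modulus at most 2. *)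
Lemma fejer_kernel_decay N y : (1 - cos y) * fejer_kernel N y <= 2 / N.+1%:R.
Proof.
have E : Normc.normc (cis y - 1) ^+ 2 = 2 * (1 - cos y) :> R.
  rewrite normc_sqrE /=; have := cos2Dsin2 y.
  by rewrite subr0 => h; rewrite -[sin y ^+ 2](addKr (cos y ^+ 2)) h; ring.
have n1 : Normc.normc (cis y) = 1 :> R.
  by rewrite /Normc.normc /= cos2Dsin2 sqrtr1.
have nX j : Normc.normc (cis y ^+ j) = 1 :> R.
  by elim: j => [|j IH]; rewrite ?expr0 ?Normc.normc1// exprS Normc.normcM n1 IH mulr1.
have le2 : Normc.normc (cis y ^+ N.+1 - 1) <= 2 :> R.
  apply: le_trans (le_normcD _ _) _.
  by rewrite normcN nX Normc.normc1.
have : 2 * ((1 - cos y) * Normc.normc (\sum_(j < N.+1) cis y ^+ j) ^+ 2) <= 4.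
  rewrite mulrA -E -exprMn -Normc.normcM -subrX1.
  rewrite (_ : 4 = 2 ^+ 2); last by ring.
  by rewrite ler_sqr ?nnegrE ?normc_ge0.
move=> H; rewrite fejer_kernelE mulrCA [leRHS]mulrC.
by rewrite ler_wpM2l ?invr_ge0//; lra.
Qed.

Let cosI h k := Rintegral mu D (fun y => h y * cos (k%:~R * y)).
Let sinI h k := Rintegral mu D (fun y => h y * sin (k%:~R * y)).

Lemma has_integral_bounded_mul h (f : R -> R) : integrable_on h -> continuous f ->
  (forall x, `|f x| <= 1) ->
  has_integral D (fun y => h y * f y) (Rintegral mu D (fun y => h y * f y)).
Proof.
move=> hi cf f1; apply: (integrable_has_integral mD).
have mf : measurable_fun (D : set (measurableTypeR R)) f.
  by apply: measurable_funTS; exact: continuous_measurable_fun.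
have mh : measurable_fun (D : set (measurableTypeR R)) h.
  by apply/measurable_EFinP; exact: (measurable_int mu hi).
apply: (le_integrable mD _ _ hi).
  by apply/measurable_EFinP; exact: measurable_funM.
by move=> x Dx; rewrite /= lee_fin normrM ler_piMr.
Qed.

(** The convolution with the kernel over [fund_dom], divided by [2 pi] and expanded by the addition
    formula into a trigonometric polynomial in [x]. *)
Definition fejer_mean N h x : R :=
  (2 * pi)^-1 * (N.+1%:R^-1 * \sum_(j < N.+1) \sum_(k < N.+1)
    (cosI h (j%:Z - k%:Z) * cos ((j%:Z - k%:Z)%:~R * x) +
     sinI h (j%:Z - k%:Z) * sin ((j%:Z - k%:Z)%:~R * x))).

Let pi2_gt0 : 0 < 2 * pi :> R.
Proof. by rewrite mulr_gt0// pi_gt0. Qed.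

Lemma has_integral_fejer N h x : integrable_on h ->
  has_integral D (fun y => h y * fejer_kernel N (x - y)) (2 * pi * fejer_mean N h x).
Proof.
move=> hi; rewrite /fejer_mean mulVKf ?gt_eqF//.
pose f y := N.+1%:R^-1 * \sum_(j < N.+1) \sum_(k < N.+1)
  (cos ((j%:Z - k%:Z)%:~R * x) * (h y * cos ((j%:Z - k%:Z)%:~R * y)) +
   sin ((j%:Z - k%:Z)%:~R * x) * (h y * sin ((j%:Z - k%:Z)%:~R * y))).
apply: (@has_integral_eq _ _ f).
  move=> y; rewrite /f /fejer_kernel mulrCA; congr (_ * _).
  rewrite mulr_sumr; apply: eq_bigr => j _; rewrite mulr_sumr; apply: eq_bigr => k _.
  by rewrite mulrBr cosB; ring.
apply: (has_integralZ _ mD); apply: (has_integral_sum _ mD) => j _.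
apply: (has_integral_sum _ mD) => k _.
rewrite (mulrC (cosI _ _)) (mulrC (sinI _ _)).
apply: (has_integralD mD); apply: (has_integralZ _ mD); apply: has_integral_bounded_mul => //.
- exact: continuous_cos_scale.
- by move=> z; exact: cos_max.
- exact: continuous_sin_scale.
- by move=> z; exact: sin_max.
Qed.

Lemma has_integral_fejer_kernel N x :
  has_integral D (fun y => fejer_kernel N (x - y)) (2 * pi).
Proof.
pose f y := N.+1%:R^-1 * \sum_(j < N.+1) \sum_(k < N.+1)
  (cos ((j%:Z - k%:Z)%:~R * x) * cos ((j%:Z - k%:Z)%:~R * y) +
   sin ((j%:Z - k%:Z)%:~R * x) * sin ((j%:Z - k%:Z)%:~R * y)).
apply: (@has_integral_eq _ _ f).
  move=> y; rewrite /f /fejer_kernel; congr (_ * _).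
  apply: eq_bigr => j _; apply: eq_bigr => k _.
  by rewrite mulrBr cosB.
have E : 2 * pi = N.+1%:R^-1 * \sum_(j < N.+1) \sum_(k < N.+1)
  (cos ((j%:Z - k%:Z)%:~R * x) * (if j%:Z - k%:Z == 0 then 2 * pi else 0) +
   sin ((j%:Z - k%:Z)%:~R * x) * 0).
  rewrite (eq_bigr (fun=> 2 * pi)) => [|j _].
    by rewrite sumr_const card_ord -(mulr_natl (2 * pi)) mulKf// pnatr_eq0.
  rewrite (bigD1 j)//= subrr eqxx mul0r cos0 mulr0 addr0 mul1r big1 ?addr0// => k kj.
  rewrite subr_eq0 eqz_nat -val_eqE /= eq_sym in kj *.
  by rewrite (negbTE kj) !mulr0 addr0.
rewrite [X in has_integral _ _ X]E.
apply: (has_integralZ _ mD); apply: (has_integral_sum _ mD) => j _.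
apply: (has_integral_sum _ mD) => k _.
apply: (has_integralD mD); apply: (has_integralZ _ mD).
  exact: has_integral_cos_period.
exact: has_integral_sin_period.
Qed.

(** Only the [N + 1] diagonal terms survive integration. Together with [fejer_mean_norm_le], this
    makes the means contractions of L^1. *)
Lemma has_integral_fejer_mean N h : has_integral D (fejer_mean N h) (Rintegral mu D h).
Proof.
have E : Rintegral mu D h = (2 * pi)^-1 * (N.+1%:R^-1 * \sum_(j < N.+1) \sum_(k < N.+1)
  (cosI h (j%:Z - k%:Z) * (if j%:Z - k%:Z == 0 then 2 * pi else 0) +
   sinI h (j%:Z - k%:Z) * 0)).
  rewrite (eq_bigr (fun=> Rintegral mu D h * (2 * pi))) => [|j _].
    rewrite sumr_const card_ord -(mulr_natl (Rintegral _ _ _ * _)) mulKf ?pnatr_eq0//.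
    by rewrite mulrC mulfK// gt_eqF.
  rewrite (bigD1 j)//= subrr eqxx mulr0 addr0 big1 ?addr0.
    congr (_ * _); rewrite /cosI; congr (Rintegral _ _ _).
    by apply/funext => y; rewrite mul0r cos0 mulr1.
  move=> k kj; rewrite subr_eq0 eqz_nat -val_eqE /= eq_sym in kj *.
  by rewrite (negbTE kj) !mulr0 addr0.
rewrite E /fejer_mean.
apply: (has_integralZ _ mD); apply: (has_integralZ _ mD).
apply: (has_integral_sum _ mD) => j _; apply: (has_integral_sum _ mD) => k _.
apply: (has_integralD mD); apply: (has_integralZ _ mD).
  exact: has_integral_cos_period.
exact: has_integral_sin_period.
Qed.

Lemma fejer_meanB N h h' x : integrable_on h -> integrable_on h' ->
  fejer_mean N (fun y => h y - h' y) x = fejer_mean N h x - fejer_mean N h' x.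
Proof.
move=> hi hi'.
have hB : integrable_on (fun y => h y - h' y).
  by apply: (eq_integrable mD _ _ _ (integrableB mD hi hi')).
have H := has_integral_Rintegral (has_integral_fejer N x hB).
have H1 := has_integralZ (-1) mD (has_integral_fejer N x hi').
have := has_integral_Rintegral (has_integralD mD (has_integral_fejer N x hi) H1).
under [X in Rintegral _ _ X]funext => y.
  rewrite mulN1r -mulrBl; over.
rewrite H mulN1r -mulrBr => /(mulfI _) ->//; by rewrite gt_eqF.
Qed.

(** The kernel is nonnegative, so the absolute value can be moved inside the convolution. *)
Lemma fejer_mean_norm_le N h x : integrable_on h ->
  `|fejer_mean N h x| <= fejer_mean N (fun y => `|h y|) x.
Proof.
move=> hi.
have hn : integrable_on (fun y => `|h y|) by exact: integrable_norm.
rewrite -(ler_pM2l pi2_gt0) -[X in X * `|_|]gtr0_norm// -normrM.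
apply: (has_integral_norm_le mD (has_integral_fejer N x hi) (has_integral_fejer N x hn)).
by move=> y _; rewrite normrM [X in _ * X]ger0_norm// fejer_kernel_ge0.
Qed.

End Fejer.

(** * Convergence of Fejer means of continuous functions *)

Section FejerConvergence.
Context {R : realType}.
Local Notation mu := (@lebesgue_measure R).
Local Notation D := (@fund_dom R).
Local Notation mD := (@measurable_fund_dom R).
Local Notation integrable_on h := (mu.-integrable D (EFin \o h)).
Implicit Types (h : R -> R) (x y : R) (N : nat).

Let pi2_gt0 : 0 < 2 * pi :> R.
Proof. by rewrite mulr_gt0// pi_gt0. Qed.

Lemma continuous_bounded_fund_dom h : continuous h ->
  exists2 M, 0 <= M & forall x, D x -> `|h x| <= M.
Proof.
move=> ch.
have cn : {within `[0, 2 * pi], continuous (fun x => `|h x|)}.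
  apply: continuous_subspaceT => x.
  by apply: (@continuous_comp _ _ _ h Num.norm); [exact: ch|exact: norm_continuous].
have [c _ hc] := EVT_max (ltW pi2_gt0) cn.
by exists `|h c|.
Qed.

Lemma continuous_integrable_fund_dom h : continuous h -> integrable_on h.
Proof.
move=> ch; apply: continuous_compact_integrable; first exact: segment_compact.
exact: continuous_subspaceT.
Qed.

Lemma fejer_mean_bounded N h M x : integrable_on h -> (forall y, D y -> `|h y| <= M) ->
  `|fejer_mean N h x| <= M.
Proof.
move=> hi hM; rewrite -(ler_pM2l pi2_gt0) -[X in X * `|_|]gtr0_norm// -normrM mulrC.
rewrite [leRHS]mulrC [X in `|X|]mulrC.
apply: (has_integral_norm_le mD (has_integral_fejer N x hi)
  (has_integralZ M mD (has_integral_fejer_kernel N x))).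
move=> y Dy; rewrite normrM [X in _ * X]ger0_norm ?fejer_kernel_ge0//.
by rewrite ler_wpM2r ?fejer_kernel_ge0// hM.
Qed.

(** The cosine decreases on [[0, pi]]; arguments beyond [pi] are reflected by [v -> 2 pi - v]. *)
Let cos_le_gap (d v : R) : 0 < d <= pi -> d <= `|v| <= 2 * pi - d -> cos v <= cos d.
Proof.
move=> /andP[d0 dpi]; rewrite -(cos_norm v); move: `|v| => {}v /andP[dv vd].
have mono (a b : R) : 0 <= a -> a <= b -> b <= pi -> cos b <= cos a.
  move=> a0 ab bp; rewrite leNgt ltr_cos -?leNgt// in_itv/=.
    by rewrite (le_trans a0 ab).
  by rewrite a0 (le_trans ab bp).
have [vp|pv] := leP v pi; first by apply: mono => //; exact: ltW.
have -> : cos v = cos (2 * pi - v).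
  rewrite -cosN -(cosD2pi (- v)); congr cos; rewrite mulr2n; ring.
by apply: mono; lra.
Qed.

(** The kernel is an approximate identity: near [x] continuity is used, and away from [x] the decay
    of the kernel. The point is interior because [h] is not assumed periodic. *)
Lemma fejer_mean_cvg h x : continuous h -> 0 < x < 2 * pi ->
  fejer_mean N h x @[N --> \oo] --> h x.
Proof.
move=> ch /andP[x0 x1].
have [M M0 hM] := continuous_bounded_fund_dom ch.
have Dx : D x by rewrite /fund_dom /= in_itv /= !ltW.
have hi := continuous_integrable_fund_dom ch.
apply/cvgrPdist_le => e e0.
have e20 : 0 < e / 2 by rewrite divr_gt0.
have /cvgrPdist_lt/(_ _ e20) := ch x.
move=> /nbhs_ballP[d /= d0 hd].
(* The bounds [r <= x] and [r <= 2 pi - x] keep [|x - y| <= 2 pi - r] on [fund_dom], away from the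
   other zeros of [1 - cos]. *)
pose r := Num.min d (Num.min x (2 * pi - x)).
have r0 : 0 < r by rewrite !lt_min d0 x0 subr_gt0.
have rd : r <= d by rewrite ge_min lexx.
have rx : r <= x by rewrite !ge_min lexx orbT.
have rx' : r <= 2 * pi - x by rewrite !ge_min lexx !orbT.
have rpi : r <= pi by lra.
have eta0 : 0 < 1 - cos r.
  rewrite subr_gt0 -cos0; have := @ltr_cos R 0 r.
  by rewrite !in_itv/= lexx pi_ge0 (ltW r0) rpi => ->.
(* Chosen so that [|h y - h x| <= 2 M <= K (1 - cos (x - y))] for [y] at distance at least [r]. *)
pose K := 2 * M / (1 - cos r).
have K0 : 0 <= K by rewrite divr_ge0 ?mulr_ge0// ltW.
have pw N y : D y -> `|(h y - h x) * fejer_kernel N (x - y)| <=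
    e / 2 * fejer_kernel N (x - y) + K * (2 / N.+1%:R).
  move=> Dy; rewrite normrM [X in _ * X]ger0_norm ?fejer_kernel_ge0//.
  have F0 := fejer_kernel_ge0 N (x - y).
  have c1 : 0 <= 1 - cos (x - y) by rewrite subr_ge0 cos_le1.
  have [near|far] := ltP `|x - y| r.
    have : `|h y - h x| <= e / 2.
      by rewrite distrC ltW//; apply: hd; rewrite /ball /=; exact: lt_le_trans rd.
    move=> /(ler_wpM2r F0) => /le_trans; apply; rewrite lerDl.
    by rewrite mulr_ge0// divr_ge0.
  have : cos (x - y) <= cos r.
    apply: cos_le_gap; first by rewrite r0.
    rewrite far /=; move: Dy; rewrite /fund_dom /= in_itv/= => /andP[y0 y1].
    by rewrite ler_norml; apply/andP; split; lra.
  move=> cr.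
  have h2 : `|h y - h x| <= K * (1 - cos (x - y)).
    apply: (@le_trans _ _ (2 * M)).
      apply: le_trans (ler_normB _ _) _; have := hM _ Dx; have := hM _ Dy; lra.
    rewrite /K -mulrA ler_peMr ?mulr_ge0// mulrC ler_pdivlMr// mul1r; lra.
  move: (ler_wpM2r F0 h2) => /le_trans; apply.
  rewrite -[leLHS]mulrA; apply: (@le_trans _ _ (K * (2 / N.+1%:R))).
    by rewrite ler_wpM2l// fejer_kernel_decay.
  by rewrite lerDr mulr_ge0// ltW.
have main N : `|fejer_mean N h x - h x| <= e / 2 + K * (2 / N.+1%:R).
  rewrite -(ler_pM2l pi2_gt0) -[X in X * `|_|]gtr0_norm// -normrM.
  have I1 := has_integral_fejer_kernel N x.
  have I2 := has_integralD mD (has_integral_fejer N x hi) (has_integralZ (- h x) mD I1).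
  have I3 := has_integralD mD (has_integralZ (e / 2) mD I1)
     (has_integral_cst (K * (2 / N.+1%:R)) pi2_gt0).
  rewrite mulrDr mulrN -mulrN (mulrC _ (- h x)).
  rewrite [leRHS](_ : _ = e / 2 * (2 * pi) + K * (2 / N.+1%:R) * (2 * pi - 0)); last by ring.
  apply: (has_integral_norm_le mD I2 I3) => y Dy.
  by rewrite -mulrDl; exact: pw.
near=> N.
rewrite distrC; apply: le_trans (main N) _.
rewrite [leRHS](splitr e) lerD2l.
suff : K * 2 * (N.+1%:R)^-1 <= e / 2 by rewrite mulrA.
rewrite ler_pdivrMr//.
have : 4 * K / e <= N%:R.
  near: N; exact: nbhs_infty_ger.
rewrite ler_pdivrMr// => H.
by rewrite -[N.+1%:R]natr1; lra.
Unshelve. all: by end_near. Qed.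

Lemma fejer_mean_measurable N h : measurable_fun (D : set (measurableTypeR R)) (EFin \o fejer_mean N h).
Proof. by have [fi _] := has_integral_fejer_mean N h; exact: (measurable_int mu fi). Qed.

(** Dominated convergence: a bound of [h] on [fund_dom] also bounds its means, and only the two
    endpoints are exceptional. *)
Lemma fejer_mean_L1_continuous h : continuous h ->
  (\int[mu]_(x in D) (`|fejer_mean N h x - h x|)%:E)%E @[N --> \oo] --> 0%E.
Proof.
move=> ch; have [M M0 hM] := continuous_bounded_fund_dom ch.
have hi := continuous_integrable_fund_dom ch.
have [] := @dominated_convergence _ _ _ mu D mD (fun N => EFin \o fejer_mean N h)
  (EFin \o h) (cst M%:E).
- move=> N; exact: fejer_mean_measurable.
- exact: (measurable_int mu hi).
- exists [set 0; 2 * pi]; split.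
  + by apply: measurableU; exact: measurable_set1.
  + by apply: countable_lebesgue_measure0; apply: finite_set_countable.
  move=> x /= nx; apply: contrapT => /not_orP[/eqP x0 /eqP x1]; apply: nx => Dx.
  suff H : fejer_mean N h x @[N --> \oo] --> h x.
    by apply: (@cvg_EFin _ _ _ _ (fun N => (fejer_mean N h x)%:E)) H; near=> N.
  apply: fejer_mean_cvg => //; move: Dx; rewrite /fund_dom /= in_itv/= => /andP[a b].
  by rewrite !lt_neqAle a b x1 eq_sym x0.
- by have [fi _] := has_integral_cst M pi2_gt0; exact: fi.
- apply: (@aeW _ _ _ mu) => x N Dx; rewrite lee_fin; exact: fejer_mean_bounded.
by move=> _ + _.
Unshelve. all: by end_near. Qed.

End FejerConvergence.

(** * Convergence in L^1 and lower semicontinuity of the fourth power *)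

Section LowerSemicontinuity.
Context {R : realType}.
Local Notation mu := (@lebesgue_measure R).
Local Notation D := (@fund_dom R).
Local Notation mD := (@measurable_fund_dom R).
Local Notation integrable_on h := (mu.-integrable D (EFin \o h)).
Implicit Types (h : R -> R) (x y : R) (N : nat).

Lemma limn_einf_ge (u : (\bar R)^nat) (a : \bar R) :
  (\forall N \near \oo, (a <= u N)%E) -> (a <= limn_einf u)%E.
Proof.
move=> [n0 _ H]; rewrite limn_einf_lim; apply: lime_ge; first exact: is_cvg_einfs.
near=> n; apply: le_ereal_inf_tmp => _ [m /= nm <-]; apply: H => /=.
by apply: leq_trans nm; near: n; exact: nbhs_infty_ge.
Unshelve. all: by end_near. Qed.

Lemma limn_einf_le (u : (\bar R)^nat) (a : \bar R) :
  (forall N, (u N <= a)%E) -> (limn_einf u <= a)%E.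
Proof.
move=> H; rewrite limn_einf_lim; apply: lime_le; first exact: is_cvg_einfs.
near=> n; apply: le_trans (H n); apply: ereal_inf_lbound; exists n => //=.
Unshelve. all: by end_near. Qed.

Lemma integrable_fejer_mean N h : integrable_on (fejer_mean N h).
Proof. exact: (has_integral_fejer_mean N h).1. Qed.

Lemma integrable_onB h h' : integrable_on h -> integrable_on h' ->
  integrable_on (fun x => h x - h' x).
Proof. by move=> hi hi'; apply: (eq_integrable mD _ _ _ (integrableB mD hi hi')). Qed.

(** Approximation of [h] in L^1 by a continuous function; by contraction the means of the error are
    no larger than the error, so three terms of size [e / 3] remain. *)
Lemma fejer_mean_L1 h (e : R) : integrable_on h -> 0 < e ->
  \forall N \near \oo, exists2 v,
    has_integral D (fun x => `|fejer_mean N h x - h x|) v & v <= e.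
Proof.
move=> hi e0.
have norm_int h' : integrable_on h' -> has_integral D (fun x => `|h' x|)
    (Rintegral mu D (fun x => `|h' x|)).
  by move=> h'i; apply: (integrable_has_integral mD); exact: integrable_norm.
have fD : (mu D < +oo)%E by rewrite lebesgue_measure_itv /=; case: ifP => // _; rewrite ltry.
have e30 : 0 < e / 3 by rewrite divr_gt0.
have [g_ [cg gi g_cvg]] := approximation_continuous_integrable mD fD hi.
have [n ng] : exists n, Rintegral mu D (fun x => `|h x - g_ n x|) <= e / 3.
  have /fine_cvgP[_ /cvgrPdist_le/(_ _ e30)[n _ /(_ n (leqnn n))]] := g_cvg.
  rewrite /= sub0r normrN => H; exists n; apply: le_trans (ler_norm _) _.
  exact: H.
have := fejer_mean_L1_continuous (cg n).
move=> /fine_cvgP[_ /cvgrPdist_le/(_ _ e30)] H.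
near=> N.
have Hn : Rintegral mu D (fun x => `|fejer_mean N (g_ n) x - g_ n x|) <= e / 3.
  apply: le_trans (ler_norm _) _.
  by have : `|0 - fine (\int[mu]_(x in D) (`|fejer_mean N (g_ n) x - g_ n x|)%:E)%E| <= e / 3;
     [near: N; exact: H|rewrite sub0r normrN].
have hgi := integrable_onB hi (gi n).
have I1 := has_integral_fejer_mean N (fun x => `|h x - g_ n x|).
have I2 := norm_int _ (integrable_onB (integrable_fejer_mean N (g_ n)) (gi n)).
have I3 := norm_int _ hgi.
have I := norm_int _ (integrable_onB (integrable_fejer_mean N h) hi).
eexists; first exact: I.
rewrite -[e](divfK (_ : 3 != 0))//.
apply: (@le_trans _ _ (Rintegral mu D (fun x => `|h x - g_ n x|) +
  Rintegral mu D (fun x => `|fejer_mean N (g_ n) x - g_ n x|) +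
  Rintegral mu D (fun x => `|h x - g_ n x|))); last by lra.
apply: (has_integral_le mD mD _ I
  (has_integralD mD (has_integralD mD I1 I2) I3)) => //.
  move=> x Dx; rewrite !addr_ge0//.
  by apply: le_trans (fejer_mean_norm_le N x hgi); exact: normr_ge0.
move=> x Dx.
have := fejer_mean_norm_le N x hgi; rewrite (fejer_meanB _ _ hi (gi n)) => F.
have -> : fejer_mean N h x - h x = (fejer_mean N h x - fejer_mean N (g_ n) x)
  + (fejer_mean N (g_ n) x - g_ n x) - (h x - g_ n x) by ring.
apply: le_trans (ler_normB _ _) _; rewrite lerD2r.
by apply: le_trans (ler_normD _ _) _; rewrite lerD2r.
Unshelve. all: by end_near. Qed.

(** The convex fourth power lies above its tangent at [a]; the difference is [(b - a)^2] times a
    form with nonnegative coefficients. *)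
Lemma pow4_ge_tangent (a b : R) : 0 <= a -> 0 <= b ->
  a ^+ 4 <= b ^+ 4 + 4 * a ^+ 3 * (a - b).
Proof.
move=> a0 b0; rewrite -subr_ge0.
have -> : b ^+ 4 + 4 * a ^+ 3 * (a - b) - a ^+ 4 =
  (b - a) ^+ 2 * (b ^+ 2 + 2 * a * b + 3 * a ^+ 2) by ring.
by rewrite mulr_ge0 ?sqr_ge0// !addr_ge0 ?mulr_ge0 ?sqr_ge0.
Qed.

Lemma normc_le_ReIm (z : R[i]) : Normc.normc z <= `|complex.Re z| + `|complex.Im z|.
Proof.
rewrite -ler_sqr ?nnegrE ?normc_ge0 ?addr_ge0// normc_sqrE sqrrD !real_normK ?num_real//.
by rewrite lerD2r lerDl mulrn_wge0// mulr_ge0.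
Qed.

Lemma measurable_normc d (T : measurableType d) (E : set T) (f : T -> R[i]) :
  measurable_fun E (fun z : T => complex.Re (f z)) ->
  measurable_fun E (fun z : T => complex.Im (f z)) ->
  measurable_fun E (fun z : T => Normc.normc (f z)).
Proof.
move=> mre mim.
rewrite (_ : (fun z : T => _) = (@Num.sqrt R) \o
   (fun z : T => complex.Re (f z) ^+ 2 + complex.Im (f z) ^+ 2)); last first.
  by apply/funext => z /=; case: (f z).
apply: measurableT_comp.
  by apply: continuous_measurable_fun; exact: sqrt_continuous.
by apply: measurable_funD; exact: measurable_funX.
Qed.

Lemma fejer_pow4_fatou (f : R -> R[i]) (V : nat -> R -> R[i]) (p : nat -> R) :
  cintegrable D f ->
  (forall N x, complex.Re (V N x) = fejer_mean N (fun y => complex.Re (f y)) x) ->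
  (forall N x, complex.Im (V N x) = fejer_mean N (fun y => complex.Im (f y)) x) ->
  (forall N, has_integral D (fun x => Normc.normc (V N x) ^+ 4) (p N)) ->
  (\int[mu]_(x in D) (Normc.normc (f x) ^+ 4)%:E <= limn_einf (fun N => (p N)%:E))%E.
Proof.
move=> [fre fim] VRe VIm pV.
set a := fun x => Normc.normc (f x).
have a0 x : 0 <= a x by exact: normc_ge0.
have ma : measurable_fun (D : set (measurableTypeR R)) a.
  apply: measurable_normc; apply/measurable_EFinP.
    exact: (measurable_int mu fre).
  exact: (measurable_int mu fim).
(* Truncating at [M] makes the tangent slope [4 a^3] bounded, so that convergence
   of the means in L^1 is enough. *)
pose q (M : nat) x := Num.min (a x) M%:R ^+ 4.
have q0 M x : 0 <= q M x by rewrite exprn_ge0// le_min a0 ler0n.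
have mq M : measurable_fun (D : set (measurableTypeR R)) (q M).
  by apply: measurable_funX; apply: measurable_minr.
have q_le M x : q M x <= M%:R ^+ 4.
  by rewrite lerXn2r ?nnegrE ?le_min ?a0 ?ler0n// ge_min lexx orbT.
have qi M : integrable_on (q M).
  have [ci _] := @has_integral_cst R 0 (2 * pi) (M%:R ^+ 4) ltac:(by rewrite mulr_gt0// pi_gt0).
  apply: (le_integrable mD _ _ ci); first by apply/measurable_EFinP.
  by move=> x Dx; rewrite /= lee_fin !ger0_norm// exprn_ge0.
have step M : (\int[mu]_(x in D) (q M x)%:E <= limn_einf (fun N => (p N)%:E))%E.
  have [_ qE] := integrable_has_integral mD (qi M); rewrite qE.
  set qM := Rintegral _ _ _ in qE *.
  apply/lee_addgt0Pr => e e0; rewrite -leeBlDr//.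
  apply: limn_einf_ge.
  (* Two errors of size [d], for the real and imaginary parts, times the slope bound give [e]. Using
     [M + 1] avoids a zero denominator at [M = 0]. *)
  pose d : R := e / 2 / (4 * M.+1%:R ^+ 3).
  have d0 : 0 < d by rewrite !divr_gt0// mulr_gt0// exprn_gt0.
  have N1 := fejer_mean_L1 fre d0; have N2 := fejer_mean_L1 fim d0.
  near=> N.
  have [v1 I1 v1d] : exists2 v, has_integral D (fun x =>
     `|fejer_mean N (fun y => complex.Re (f y)) x - complex.Re (f x)|) v & v <= d.
    by near: N; exact: N1.
  have [v2 I2 v2d] : exists2 v, has_integral D (fun x =>
     `|fejer_mean N (fun y => complex.Im (f y)) x - complex.Im (f x)|) v & v <= d.
    by near: N; exact: N2.
  rewrite -EFinB lee_fin lerBlDr.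
  have I := has_integralD mD (pV N) (has_integralZ (4 * M.+1%:R ^+ 3) mD (has_integralD mD I1 I2)).
  apply: (@le_trans _ _ (p N + 4 * M.+1%:R ^+ 3 * (v1 + v2))); last first.
    rewrite lerD2l mulrC -ler_pdivlMr; last by rewrite mulr_gt0// exprn_gt0.
    by rewrite [X in _ <= X / _](splitr e) mulrDl -/d lerD.
  apply: (has_integral_le mD mD _ (integrable_has_integral mD (qi M)) I) => // x Dx.
    by rewrite addr_ge0 ?exprn_ge0 ?normc_ge0// !mulr_ge0 ?exprn_ge0 ?addr_ge0.
  set b := Normc.normc (V N x).
  have b0 : 0 <= b by exact: normc_ge0.
  set m := Num.min (a x) M%:R.
  have m0 : 0 <= m by rewrite le_min a0 ler0n.
  have := pow4_ge_tangent m0 b0; rewrite -[m ^+ 4]/(q M x) => /le_trans; apply.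
  rewrite lerD2l -[X in _ * X <= _]/(m - b).
  set w := `|_| + `|_|.
  (* Truncation only lowers the modulus, so the difference is at most the modulus of
     [f x - V N x]. *)
  have mb : m - b <= w.
    apply: (@le_trans _ _ (a x - b)); first by rewrite lerD2r /m ge_min lexx.
    rewrite lerBlDl; apply: (@le_trans _ _ (b + Normc.normc (f x - V N x))).
      by rewrite /a -{1}(subrKC (V N x) (f x)); exact: le_normcD.
    rewrite lerD2l; apply: le_trans (normc_le_ReIm _) _.
    by rewrite /w -VRe -VIm [X in _ <= X + _]distrC [X in _ <= _ + X]distrC;
      case: (f x) => ? ?; case: (V N x).
  have w0 : 0 <= w by rewrite addr_ge0.
  have m3 : m ^+ 3 <= M.+1%:R ^+ 3.
    rewrite lerXn2r ?nnegrE// /m ge_min; apply/orP; right.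
    by rewrite ler_nat.
  apply: (@le_trans _ _ (4 * m ^+ 3 * w)).
    by rewrite ler_wpM2l// mulr_ge0// exprn_ge0.
  by rewrite ler_wpM2r// ler_wpM2l.
(* Monotone convergence removes the truncation; at each point [q M x] is constant once
   [M >= a x]. *)
have H : (\int[mu]_(x in D) (q M x)%:E)%E @[M --> \oo] -->
    (\int[mu]_(x in D) limn (fun M => (q M x)%:E))%E.
  apply: (cvg_monotone_convergence mD).
  - by move=> M; exact/measurable_EFinP.
  - by move=> M x Dx; rewrite lee_fin.
  - move=> x Dx M M' MM'; rewrite lee_fin lerXn2r ?nnegrE ?le_min ?a0 ?ler0n//.
    by rewrite ge_min lexx/= ge_min ler_nat MM' orbT.
rewrite (_ : (\int[mu]_(x in D) (a x ^+ 4)%:E)%E =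
   (\int[mu]_(x in D) limn (fun M => (q M x)%:E))%E); last first.
  apply: eq_integral => x _; apply/esym/cvg_lim => //.
  apply: cvg_near_cst; near=> M; rewrite /q; congr (_ ^+ 4)%:E.
  apply/min_idPl; near: M; exact: nbhs_infty_ger.
rewrite -(cvg_lim _ H)//.
by apply: lime_le; [apply/cvg_ex; eexists; exact: H|near=> M; exact: step].
Unshelve. all: by end_near. Qed.

End LowerSemicontinuity.

Local Open Scope complex_scope.

(** * Fejer means as finite sums *)

Section FejerTruncation.
Context {R : realType}.
Local Notation mu := (@lebesgue_measure R).
Local Notation D := (@fund_dom R).
Local Notation mD := (@measurable_fund_dom R).

(** The Cesaro mean of the series with coefficients [c], kept as a double sum so that it can be
    compared with [fejer_mean] term by term. *)
Definition fejer_sum (c : int -> R[i]) (N : nat) (x : R) : R[i] :=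
  \sum_(j < N.+1) \sum_(k < N.+1)
    ((N.+1%:R^-1)%:C * c (j%:Z - k%:Z) * cis ((j%:Z - k%:Z)%:~R * x))%C.

Let cosI (h : R -> R) k := Rintegral mu D (fun y => h y * cos (k%:~R * y)).
Let sinI (h : R -> R) k := Rintegral mu D (fun y => h y * sin (k%:~R * y)).

Lemma fourier_coefE (f : R -> R[i]) k : cintegrable D f ->
  fourier_coef f k =
    ((2 * pi)^-1 * (cosI (fun y => complex.Re (f y)) k + sinI (fun y => complex.Im (f y)) k)) +i*
    ((2 * pi)^-1 * (cosI (fun y => complex.Im (f y)) k - sinI (fun y => complex.Re (f y)) k)).
Proof.
move=> [fre fim].
have hc h : mu.-integrable D (EFin \o h) ->
    has_integral D (fun y => h y * cos (k%:~R * y)) (cosI h k).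
  by move=> hi; apply: (has_integral_bounded_mul hi);
       [exact: continuous_cos_scale|move=> x; exact: cos_max].
have hs h : mu.-integrable D (EFin \o h) ->
    has_integral D (fun y => h y * sin (k%:~R * y)) (sinI h k).
  by move=> hi; apply: (has_integral_bounded_mul hi);
       [exact: continuous_sin_scale|move=> x; exact: sin_max].
have H1 := has_integralD mD (hc _ fre) (hs _ fim).
have H2 := has_integralD mD (hc _ fim) (has_integralZ (-1) mD (hs _ fre)).
apply/eqP; rewrite eq_complex /fourier_coef Re_mulc Im_mulc /= !mul0r subr0 addr0.
apply/andP; split; apply/eqP; congr (_ * _).
  rewrite -(has_integral_Rintegral H1); congr (Rintegral _ _ _); apply/funext => y.
  by rewrite Re_mulc /= cosN sinN; ring.
rewrite -mulN1r -(has_integral_Rintegral H2); congr (Rintegral _ _ _); apply/funext => y.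
by rewrite Im_mulc /= cosN sinN; ring.
Qed.

Lemma antisymmetric_sum (n : nat) (X : 'I_n -> 'I_n -> R) :
  (forall j k, X j k = - X k j) -> \sum_j \sum_k X j k = 0.
Proof.
move=> anti; have : \sum_j \sum_k X j k = - \sum_j \sum_k X j k.
  rewrite [in LHS]exchange_big -sumrN; apply: eq_bigr => j _.
  by rewrite -sumrN; apply: eq_bigr => k _; exact: anti.
by move/eqP; rewrite -addr_eq0 -mulr2n mulrn_eq0 /= => /eqP.
Qed.

Let cosIN h k : cosI h (- k) = cosI h k.
Proof.
by congr (Rintegral _ _ _); apply/funext => y; rewrite mulrNz mulNr cosN.
Qed.

Let sinIN h k : mu.-integrable D (EFin \o h) -> sinI h (- k) = - sinI h k.
Proof.
move=> hi; have H : has_integral D (fun y => h y * sin (k%:~R * y)) (sinI h k).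
  by apply: (has_integral_bounded_mul hi);
       [exact: continuous_sin_scale|move=> x; exact: sin_max].
rewrite -[RHS]mulN1r -(has_integral_Rintegral (has_integralZ (-1) mD H)).
by congr (Rintegral _ _ _); apply/funext => y; rewrite mulrNz mulNr sinN; ring.
Qed.

(* The summands of [fejer_sum] and [fejer_mean] differ by terms odd in [j - k]. *)
Lemma Re_fejer_sum (f : R -> R[i]) N x : cintegrable D f ->
  complex.Re (fejer_sum (fourier_coef f) N x) =
  fejer_mean N (fun y => complex.Re (f y)) x.
Proof.
move=> fi; move: (fun k => fourier_coefE k fi).
move: (fourier_coef f) => c cE; rewrite /fejer_sum Re_sum.
under eq_bigr do rewrite Re_sum.
rewrite /fejer_mean.
(* A zero is added on the right, to be replaced by the vanishing sum of the odd terms; afterwards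
   the summands agree. *)
have -> : forall a b c : R, a * (b * c) = a * (b * c) + a * (b * 0) by move=> *; ring.
rewrite -[X in _ + _ * (_ * X)](@antisymmetric_sum N.+1 (fun j k =>
  sinI (fun y => complex.Im (f y)) (j%:Z - k%:Z) * cos ((j%:Z - k%:Z)%:~R * x)
  - cosI (fun y => complex.Im (f y)) (j%:Z - k%:Z) * sin ((j%:Z - k%:Z)%:~R * x))); last first.
  move=> j k; rewrite -(opprB k%:Z) cosIN sinIN; last by case: fi.
  by rewrite (mulrNz 1) (mulNr _ x) cosN sinN; ring.
rewrite -!mulrDr -big_split !mulr_sumr; apply: eq_bigr => j _ /=.
rewrite -big_split !mulr_sumr; apply: eq_bigr => k _ /=.
rewrite !Re_mulc !Im_mulc cE /=.
rewrite -/(cosI _ _) -/(sinI _ _); ring.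
Qed.

Lemma Im_fejer_sum (f : R -> R[i]) N x : cintegrable D f ->
  complex.Im (fejer_sum (fourier_coef f) N x) =
  fejer_mean N (fun y => complex.Im (f y)) x.
Proof.
move=> fi; move: (fun k => fourier_coefE k fi).
move: (fourier_coef f) => c cE; rewrite /fejer_sum Im_sum.
under eq_bigr do rewrite Im_sum.
rewrite /fejer_mean.
have -> : forall a b c : R, a * (b * c) = a * (b * c) + a * (b * 0) by move=> *; ring.
rewrite -[X in _ + _ * (_ * X)](@antisymmetric_sum N.+1 (fun j k =>
  cosI (fun y => complex.Re (f y)) (j%:Z - k%:Z) * sin ((j%:Z - k%:Z)%:~R * x)
  - sinI (fun y => complex.Re (f y)) (j%:Z - k%:Z) * cos ((j%:Z - k%:Z)%:~R * x))); last first.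
  move=> j k; rewrite -(opprB k%:Z) cosIN sinIN; last by case: fi.
  by rewrite (mulrNz 1) (mulNr _ x) cosN sinN; ring.
rewrite -!mulrDr -big_split !mulr_sumr; apply: eq_bigr => j _ /=.
rewrite -big_split !mulr_sumr; apply: eq_bigr => k _ /=.
rewrite !Im_mulc !Re_mulc cE /=.
rewrite -/(cosI _ _) -/(sinI _ _); ring.
Qed.

Definition trunc_freq (N : nat) (i : 'I_(N + N).+1) : int := i%:Z - N%:Z.

Lemma trunc_freq_inj N : injective (@trunc_freq N).
Proof. by move=> i j /addIr [] /val_inj. Qed.

(** The difference [j - k] shifted by [N]. As [k <= N], the natural subtraction is exact, and the
    value stays within the range of [inord]. *)
Let diff_index N (p : 'I_N.+1 * 'I_N.+1) : 'I_(N + N).+1 := inord (p.1 + N - p.2)%N.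

Let diff_indexE N p : trunc_freq (@diff_index N p) = p.1%:Z - p.2%:Z.
Proof.
have h1 := ltn_ord p.1; have h2 := ltn_ord p.2.
by rewrite /trunc_freq /diff_index inordK; lia.
Qed.

(* The number of [(j, k)] with [j - k = trunc_freq i], over [N + 1]; that is,
   [1 - `|trunc_freq i| / (N + 1)]. *)
Definition fejer_weight (N : nat) (i : 'I_(N + N).+1) : R :=
  #|[pred p | @diff_index N p == i]|%:R / N.+1%:R.

Lemma fejer_weight_ge0 N i : 0 <= @fejer_weight N i.
Proof. by rewrite divr_ge0. Qed.

(** For a fixed difference the first entry determines the pair, so there are at most [N + 1]
    pairs. *)
Lemma fejer_weight_le1 N i : @fejer_weight N i <= 1.
Proof.
rewrite ler_pdivrMr ?ltr0n// mul1r ler_nat.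
have inj : {in [pred p | @diff_index N p == i] &, injective fst}.
  move=> [j k] [j' k']; rewrite !inE /= => /eqP e /eqP e' jj; rewrite -{j'}jj in e' *.
  have := diff_indexE (j, k); have := diff_indexE (j, k'); rewrite e e' /= => -> h.
  by congr (_, _); apply: val_inj => /=; lia.
rewrite -(card_in_image inj) -[X in (_ <= X)%N](card_ord N.+1); exact: max_card.
Qed.

(** Grouping pairs by their difference collects the Fejer weights. The time dependence sits only in
    the phases, so the coefficients of the resulting [disp_sum] are the same for all [t]. *)
Lemma fejer_sum_disp (g t : R) (a c : int -> R[i]) N x :
  (forall k, c k = cis (t * `|k%:~R| `^ g) * a k) ->
  fejer_sum c N x =
  disp_sum g (@trunc_freq N) (fun i => ((fejer_weight i)%:C * a (trunc_freq i))%C) t x.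
Proof.
move=> cE; rewrite /fejer_sum pair_big /disp_sum /=.
rewrite (partition_big (@diff_index N) predT)//=; apply: eq_bigr => i _.
rewrite (eq_bigr (fun=> ((N.+1%:R^-1)%:C * c (trunc_freq i) * cis ((trunc_freq i)%:~R * x))%C)).
  rewrite sumr_const cE -[LHS]mulr_natl /fejer_weight rmorphM /= rmorph_nat.
  set K := #|_|.
  by ring.
by move=> p /eqP <-; rewrite diff_indexE.
Qed.

End FejerTruncation.

(** * Passage to the limit *)

Section Strichartz.
Context {R : realType}.
Local Notation mu := (@lebesgue_measure R).
Local Notation D := (@fund_dom R).
Local Notation mD := (@measurable_fund_dom R).

Lemma sum_le_esum (I : finType) (n : I -> int) (F : int -> R) : injective n ->
  ((\sum_i F (n i))%:E <= \esum_(k in [set: int]) (F k)%:E)%E.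
Proof.
move=> n_inj; apply: esum_ge.
pose r := [seq n i | i <- enum I].
exists [set` r]; first by split => //; exact: finite_seq.
rewrite -fsbig_seq; last by rewrite map_inj_uniq ?enum_uniq.
by rewrite big_map big_enum/= sumEFin.
Qed.

Lemma pow4_tonelli (u : R -> R -> R[i]) : spacetime_measurable u ->
  (L4_spacetime_norm u =
    (\int[mu]_(t in D) \int[mu]_(x in D) (Normc.normc (u t x) ^+ 4)%:E) `^ 4^-1)%E /\
  measurable_fun (D : set (measurableTypeR R))
    (fun t => (\int[mu]_(x in D) (Normc.normc (u t x) ^+ 4)%:E)%E).
Proof.
move=> [mre mim].
pose TR := measurableTypeR R.
pose f : TR * TR -> \bar R := (fun z => (Normc.normc (u z.1 z.2) ^+ 4)%:E) \_ (D `*` D).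
have mDD : measurable (D `*` D : set (TR * TR)) by apply: measurableX; exact: mD.
have mf : measurable_fun setT f.
  apply/(measurable_restrict _ mDD measurableT); rewrite setTI.
  apply/measurable_EFinP; apply: measurable_funX.
  by apply: (@measurable_normc R _ (TR * TR)%type _ (fun z => u z.1 z.2)).
have f0 z : (0 <= f z)%E.
  by rewrite /f /patch; case: ifP => // _; rewrite lee_fin exprn_ge0// normc_ge0.
(* The section integrals of the integrand extended by zero are the inner integrals, themselves
   extended by zero. *)
have FE : fubini_F mu f = (fun t => (\int[mu]_(x in D) (Normc.normc (u t x) ^+ 4)%:E)%E) \_ D.
  apply/funext => t; rewrite /fubini_F /patch.
  case: ifPn => tD; last first.
    apply: integral0_eq => x _; rewrite /f /patch in_setX /=.
    by rewrite (negbTE tD).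
  rewrite [RHS]integral_mkcond; apply: eq_integral => x _.
  by rewrite /f /patch in_setX /= tD.
split.
  rewrite /L4_spacetime_norm unlock; congr (_ `^ _)%E.
  rewrite [RHS]integral_mkcond -FE -fubini_tonelli1//.
  apply: eq_integral => z _; rewrite /f /patch; case: ifP => _ /=.
    by rewrite ger0_norm ?normc_ge0// powR_mulrn ?normc_ge0.
  by rewrite normr0 powR0.
rewrite -[X in measurable_fun X _]setTI.
apply/(measurable_restrict _ mD measurableT); rewrite -FE.
exact: measurable_fun_fubini_tonelli_F.
Qed.

Variables (g s : R).
Hypotheses (hg : 1 < g < 2) (hs : (2 - g) / 2 <= 4 * s).
Local Notation K := (strichartz_const g).

Lemma pow4_integral_le (f : R -> R[i]) (u : R -> R -> R[i]) (e : R) :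
  (\esum_(k in [set: int])
      (bracket k `^ (2 * s) * Normc.normc (fourier_coef f k) ^+ 2)%:E <= e%:E)%E ->
  spacetime_measurable u ->
  (forall t, D t -> cintegrable D (u t) /\ forall k,
     fourier_coef (u t) k = cis (t * `|k%:~R| `^ g) * fourier_coef f k) ->
  (\int[mu]_(t in D) \int[mu]_(x in D) (Normc.normc (u t x) ^+ 4)%:E <=
    (K * e ^+ 2)%:E)%E.
Proof.
move=> he um hu.
pose b N (i : 'I_(N + N).+1) : R[i] :=
  ((@fejer_weight R N i)%:C * fourier_coef f (trunc_freq i)).
pose E N t := disp_sum_energy g (@trunc_freq N) (@b N) t.
have inner t : D t ->
    (\int[mu]_(x in D) (Normc.normc (u t x) ^+ 4)%:E <= limn_einf (fun N => (E N t)%:E))%E.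
  move=> Dt; have [ui uc] := hu t Dt.
  apply: (fejer_pow4_fatou ui (V := fun N x => fejer_sum (fourier_coef (u t)) N x)).
  - by move=> N x; exact: Re_fejer_sum.
  - by move=> N x; exact: Im_fejer_sum.
  - move=> N; apply: has_integral_eq (has_integral_disp_sum _ _ _ _) => x.
    by rewrite (fejer_sum_disp _ _ uc).
have outer N : (\int[mu]_(t in D) (E N t)%:E <= (K * e ^+ 2)%:E)%E.
  have [v [_ ->] vle] := finite_strichartz hg hs (@b N) (@trunc_freq_inj N).
  rewrite lee_fin; apply: le_trans vle _.
  apply: ler_wpM2l; first exact: strichartz_const_ge0.
  rewrite lerXn2r ?nnegrE//.
  - by apply: sumr_ge0 => i _; rewrite mulr_ge0 ?powR_ge0 ?exprn_ge0// normc_ge0.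
  - rewrite -lee_fin; apply: le_trans he; apply: esum_ge0 => k _.
    by rewrite lee_fin mulr_ge0 ?powR_ge0 ?exprn_ge0// normc_ge0.
  rewrite -lee_fin; apply: le_trans he.
  apply: le_trans (sum_le_esum (fun k =>
    bracket k `^ (2 * s) * Normc.normc (fourier_coef f k) ^+ 2) (@trunc_freq_inj N)).
  rewrite lee_fin; apply: ler_sum => i _; rewrite ler_wpM2l ?powR_ge0//.
  rewrite lerXn2r ?nnegrE ?normc_ge0// /b Normc.normcM.
  rewrite ler_piMl ?normc_ge0//= expr0n addr0 sqrtr_sqr ger0_norm ?fejer_weight_ge0//.
  exact: fejer_weight_le1.
have mE N : measurable_fun (D : set (measurableTypeR R)) (fun t => (E N t)%:E).
  have [v [fi _] _] := finite_strichartz hg hs (@b N) (@trunc_freq_inj N).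
  exact: (measurable_int mu fi).
have E0 N t : D t -> (0 <= (E N t)%:E)%E.
  by move=> _; rewrite lee_fin; exact: disp_sum_energy_ge0.
apply: (@le_trans _ _ (\int[mu]_(t in D) limn_einf (fun N => (E N t)%:E))%E).
  apply: (ge0_le_integral mu mD).
  - by move=> t _; apply: integral_ge0 => x _; rewrite lee_fin exprn_ge0// normc_ge0.
  - by have [_ mI] := pow4_tonelli um; exact: mI.
  (* The lower limit is minus the upper limit of the negatives. *)
  - apply: measurableT_comp; first exact: oppe_measurable.
    by apply: measurable_fun_limn_esup => N; apply: measurableT_comp (mE N).
  - move=> t Dt; exact: inner.
apply: le_trans (fatou mu mD mE E0) _.
exact: limn_einf_le.
Qed.

End Strichartz.

Theorem theorem4 (R : realType) (alpha s : R)
    (halpha : 2^-1 < alpha < 1) (hs : (1 - alpha) / 4 < s) :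
  exists C : R, forall (f : R -> complex R) (u : R -> R -> complex R),
    in_sobolev s f ->
    spacetime_measurable u ->
    (forall t : R, fund_dom t -> propagator alpha t f (u t)) ->
    (L4_spacetime_norm u <= C%:E * sobolev_norm s f)%E.
Proof.
have /andP[a1 a2] := halpha.
(* The phase exponent is [g = 2 alpha], for which [(2 - g) / 2 = 1 - alpha]. *)
have hg : 1 < 2 * alpha < 2 by apply/andP; split; lra.
have hs' : (2 - 2 * alpha) / 2 <= 4 * s by lra.
have K0 := strichartz_const_ge0 (2 * alpha).
(* With [S] the squared Sobolev norm, the fourth root of [K S^2] is [K ^ (1/4)] times
   [S ^ (1/2)]. *)
exists (strichartz_const (2 * alpha) `^ 4^-1) => f u [_ fs] um hu.
have [-> _] := pow4_tonelli um.
move: fs; rewrite /sobolev_norm; set S := (\esum_(k in _) _)%E => fs.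
have S0 : (0 <= S)%E.
  by apply: esum_ge0 => k _; rewrite lee_fin mulr_ge0 ?powR_ge0 ?exprn_ge0// normc_ge0.
have Sfin : S \is a fin_num.
  by rewrite ge0_fin_numE//; apply: lty_poweRy fs.
have SE : S = (fine S)%:E by rewrite fineK.
have e0 : 0 <= fine S by rewrite fine_ge0.
have := @pow4_integral_le R (2 * alpha) s hg hs' f u (fine S) _ um.
rewrite -SE lexx => /(_ isT) H.
have {}H := H (fun t Dt => conj (hu t Dt).1.2 (hu t Dt).2).
have p0 : (0 <= 4^-1 :> R) by [].
apply: le_trans (gt0_ler_poweR p0 _ _ H) _.
- by rewrite in_itv/= leey andbT; apply: integral_ge0 => t _; apply: integral_ge0 => x _;
    rewrite lee_fin exprn_ge0// normc_ge0.
- by rewrite in_itv/= leey andbT lee_fin mulr_ge0// exprn_ge0.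
rewrite SE !poweR_EFin -EFinM lee_fin powRM ?exprn_ge0//.
rewrite ler_wpM2l ?powR_ge0// -powR_mulrn// -powRrM.
by rewrite (_ : 2 * 4^-1 = 2^-1)//; field.
Qed.
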